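(* Let $\mathbb{k}$ be an algebraically closed field, let $X$ be an affine variety over $\mathbb{k}$, and let $G$ be an affine algebraic group over $\mathbb{k}$ acting on $X$. Let $\mathcal{S}$ and $\mathcal{G}$ be the functors from commutative associative $\mathbb{k}$-algebras to sets given by $\mathcal{S}(A)=\operatorname{Hom}(\operatorname{Spec}(A),X)$ and $\mathcal{G}(A)=\operatorname{Hom}(\operatorname{Spec}(A),G)$. Let $x,y\in\mathcal{S}(\mathbb{k})$. Then the orbit $\mathcal{O}_y$ is contained in $\overline{\mathcal{O}_x}$ if and only if there exists an element $\mathcal{X}\in\mathcal{S}(\mathbb{k}[[t]])$ such that the following two equalities hold: $$\mathcal{S}(\tau)(\mathcal{X}) = g\cdot\big(\mathcal{S}(\tau\circ\eta)(x)\big)\quad\text{for some } g\in\mathcal{G}(\mathbb{k}((t))),$$ $$\mathcal{S}(\pi)(\mathcal{X}) = y,$$ where $\tau:\mathbb{k}[[t]]\to\mathbb{k}((t))$ is the inclusion map, $\eta:\mathbb{k}\to\mathbb{k}[[t]]$ is the unit map, and $\pi:\mathbb{k}[[t]]\to\mathbb{k}$ is the canonical projection (evaluation at $t=0$).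
   Context: The term affine variety means the (not necessarily irreducible) zero locus of an ideal of polynomials. $\operatorname{Hom}(\operatorname{Spec}(A),X)$ denotes morphisms over $\mathbb{k}$; equivalently, $\mathbb{k}$-algebra homomorphisms from the algebra of global sections of $X$ to $A$ (likewise for $G$). For each $A$ the group $\mathcal{G}(A)$ acts on $\mathcal{S}(A)$ via the action of $G$ on $X$; this action is denoted by a dot. For a $\mathbb{k}$-algebra morphism $f:A\to A'$, $\mathcal{S}(f):\mathcal{S}(A)\to\mathcal{S}(A')$ is the induced map. For $x\in\mathcal{S}(\mathbb{k})$, $\mathcal{O}_x$ is its orbit in $\mathcal{S}(\mathbb{k})$ under the action of $\mathcal{G}(\mathbb{k})$ and $\overline{\mathcal{O}_x}$ is the Zariski closure of this orbit. $\mathbb{k}[[t]]$ is the algebra of formal power series and $\mathbb{k}((t))$ is its fraction field, the field of Laurent series. *)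

(* Defs.v *)
From HB Require Import structures.
From mathcomp Require Import all_boot all_order all_algebra.
From mathcomp Require Import mathcomp_extra boolp classical_sets functions.
From mathcomp Require Import mpoly.

Set Implicit Arguments.
Unset Strict Implicit.
Unset Printing Implicit Defensive.

Import GRing.Theory.
Local Open Scope classical_set_scope.
Local Open Scope ring_scope.

Record fps (R : Type) := FPS { fps_coef : nat -> R }.

Section FpsNmod.
Variable R : nmodType.
HB.instance Definition _ := [isNew for @fps_coef R].
HB.instance Definition _ := [Choice of fps R by <:].
End FpsNmod.

Lemma fpsP (R : Type) (a b : fps R) : fps_coef a =1 fps_coef b <-> a = b.
Proof.
by split=> [|-> //]; case: a b => [a] [b] /= /funext ->.
Qed.

Section FpsRing.
Variable R : comNzRingType.
Implicit Types a b c : fps R.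

Definition fps0 : fps R := FPS (fun=> 0).
Definition fps1 : fps R := FPS (fun i => (i == 0%N)%:R).
Definition fps_opp a : fps R := FPS (fun i => - fps_coef a i).
Definition fps_add a b : fps R := FPS (fun i => fps_coef a i + fps_coef b i).
Definition fps_mul a b : fps R :=
  FPS (fun i => \sum_(j < i.+1) fps_coef a j * fps_coef b (i - j)%N).
Definition fps_scale (u : R) a : fps R := FPS (fun i => u * fps_coef a i).

Fact fps_addA : associative fps_add.
Proof. by move=> a b c; apply/fpsP => i /=; rewrite addrA. Qed.
Fact fps_addC : commutative fps_add.
Proof. by move=> a b; apply/fpsP => i /=; rewrite addrC. Qed.
Fact fps_add0 : left_id fps0 fps_add.
Proof. by move=> a; apply/fpsP => i /=; rewrite add0r. Qed.
Fact fps_addN : left_inverse fps0 fps_opp fps_add.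
Proof. by move=> a; apply/fpsP => i /=; rewrite addNr. Qed.

HB.instance Definition _ :=
  GRing.isZmodule.Build (fps R) fps_addA fps_addC fps_add0 fps_addN.

Let trunc m a : {poly R} := \poly_(i < m.+1) fps_coef a i.

Let coef_trunc m a i : (i <= m)%N -> (trunc m a)`_i = fps_coef a i.
Proof. by move=> im; rewrite coef_poly ltnS im. Qed.

Let fps_mulE m a b i : (i <= m)%N ->
  fps_coef (fps_mul a b) i = (trunc m a * trunc m b)`_i.
Proof.
move=> im; rewrite coefM; apply: eq_bigr => j _.
rewrite !coef_trunc //; last by rewrite (leq_trans _ im) // -ltnS.
exact: leq_trans (leq_subr _ _) im.
Qed.

Fact fps_mulC : commutative fps_mul.
Proof. by move=> a b; apply/fpsP => i; rewrite !(fps_mulE _ _ (leqnn i)) mulrC. Qed.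

Fact fps_mulA : associative fps_mul.
Proof.
move=> a b c; apply/fpsP => i.
transitivity ((trunc i a * (trunc i b * trunc i c))`_i).
  rewrite coefM; apply: eq_bigr => j _.
  have ji : (j <= i)%N by rewrite -ltnS.
  by rewrite (coef_trunc a ji) (fps_mulE b c (leq_subr j i)).
rewrite mulrA coefM; apply: eq_bigr => j _.
have ji : (j <= i)%N by rewrite -ltnS.
by rewrite (coef_trunc c (leq_subr j i)) (fps_mulE a b ji).
Qed.

Fact fps_mul1 : left_id fps1 fps_mul.
Proof.
move=> a; apply/fpsP => i /=; rewrite big_ord_recl /= mul1r subn0.
by rewrite big1 ?addr0 // => j _; rewrite mul0r.
Qed.

Fact fps_mulDl : left_distributive fps_mul fps_add.
Proof.
move=> a b c; apply/fpsP => i /=.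
by rewrite -big_split; apply: eq_bigr => j _; rewrite mulrDl.
Qed.

Fact fps1_neq0 : fps1 != 0.
Proof.
apply/eqP => /fpsP/(_ 0%N) /= /eqP.
by rewrite (negbTE (oner_neq0 R)).
Qed.

HB.instance Definition _ := GRing.Zmodule_isComNzRing.Build (fps R)
  fps_mulA fps_mulC fps_mul1 fps_mulDl fps1_neq0.

Fact fps_scaleA u v a : fps_scale u (fps_scale v a) = fps_scale (u * v) a.
Proof. by apply/fpsP => i /=; rewrite mulrA. Qed.
Fact fps_scale1 : left_id 1 fps_scale.
Proof. by move=> a; apply/fpsP => i /=; rewrite mul1r. Qed.
Fact fps_scaleDr : right_distributive fps_scale +%R.
Proof. by move=> u a b; apply/fpsP => i /=; rewrite mulrDr. Qed.
Fact fps_scaleDl a : {morph fps_scale^~ a : u v / u + v}.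
Proof. by move=> u v; apply/fpsP => i /=; rewrite mulrDl. Qed.

HB.instance Definition _ := GRing.Zmodule_isLmodule.Build R (fps R)
  fps_scaleA fps_scale1 fps_scaleDr fps_scaleDl.

Fact fps_scaleAl (u : R) a b : u *: (a * b) = (u *: a) * b.
Proof.
apply/fpsP => i /=; rewrite mulr_sumr.
by apply: eq_bigr => j _; rewrite mulrA.
Qed.

HB.instance Definition _ := GRing.Lmodule_isLalgebra.Build R (fps R) fps_scaleAl.
HB.instance Definition _ := GRing.Lalgebra_isComAlgebra.Build R (fps R).

Definition fps_unitr : {pred fps R} := fun a => `[< exists b, b * a = 1 >].
Definition fps_inv a : fps R :=
  if pselect (exists b, b * a = 1) is left ex then sval (cid ex) else a.

Fact fps_mulVr : {in fps_unitr, left_inverse 1 fps_inv *%R}.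
Proof.
move=> a /asboolP exb; rewrite /fps_inv.
by case: pselect => // ex; case: (cid ex).
Qed.
Fact fps_unitPl a b : b * a = 1 -> fps_unitr a.
Proof. by move=> ba1; apply/asboolP; exists b. Qed.
Fact fps_invr_out : {in [predC fps_unitr], fps_inv =1 id}.
Proof.
move=> a; rewrite inE => /asboolPn nex.
by rewrite /fps_inv; case: pselect.
Qed.

HB.instance Definition _ := GRing.ComNzRing_hasMulInverse.Build (fps R)
  fps_mulVr fps_unitPl fps_invr_out.

End FpsRing.

Section FpsDomain.
Variable R : idomainType.

Fact fps_idomain : GRing.integral_domain_axiom (fps R).
Proof.
move=> a b ab0; apply: contrapT => /negP; rewrite negb_or => /andP[a0 b0].
have lead (c : fps R) : c != 0 -> exists2 i,
    fps_coef c i != 0 & forall j, (j < i)%N -> fps_coef c j = 0.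
  move=> c0; have ex : exists i, fps_coef c i != 0.
    apply: contrapT => nex; move/eqP: c0; apply; apply/fpsP => i.
    by apply/eqP; apply: contrapT => /negP ci; apply: nex; exists i.
  exists (ex_minn ex); case: ex_minnP => // m cm min j jm.
  by apply/eqP; apply: contraTT jm => cj; rewrite -leqNgt min.
have [i ai mini] := lead _ a0; have [j bj minj] := lead _ b0.
have /fpsP/(_ (i + j)%N) /= := ab0.
have ilt : (i < (i + j).+1)%N by rewrite ltnS leq_addr.
rewrite (bigD1 (Ordinal ilt)) //= addKn big1 ?addr0.
  by move/eqP; rewrite mulf_eq0 (negbTE ai) (negbTE bj).
move=> l; rewrite -val_eqE /= neq_ltn => /orP[li|il].
  by rewrite mini // mul0r.
rewrite [X in _ * X]minj ?mulr0 // ltn_subLR; last by rewrite -ltnS.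
by rewrite ltn_add2r.
Qed.

HB.instance Definition _ := GRing.ComUnitRing_isIntegral.Build (fps R) fps_idomain.

End FpsDomain.

Definition laurent (k : fieldType) : Type := {fraction (fps k)}.

Section Laurent.
Variable k : fieldType.

HB.instance Definition _ := GRing.Field.on (laurent k).

Definition laurent_of_fps (a : fps k) : laurent k := tofrac a.

HB.instance Definition _ := GRing.RMorphism.copy laurent_of_fps (@tofrac (fps k)).

Definition laurent_scale (u : k) (a : laurent k) : laurent k :=
  laurent_of_fps u%:A * a.

Fact laurent_scaleA u v a :
  laurent_scale u (laurent_scale v a) = laurent_scale (u * v) a.
Proof. by rewrite /laurent_scale mulrA -rmorphM -scalerAl mul1r scalerA. Qed.
Fact laurent_scale1 : left_id 1 laurent_scale.
Proof. by move=> a; rewrite /laurent_scale scale1r rmorph1 mul1r. Qed.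
Fact laurent_scaleDr : right_distributive laurent_scale +%R.
Proof. by move=> u a b; rewrite /laurent_scale mulrDr. Qed.
Fact laurent_scaleDl a : {morph laurent_scale^~ a : u v / u + v}.
Proof. by move=> u v; rewrite /laurent_scale scalerDl rmorphD mulrDl. Qed.

HB.instance Definition _ := GRing.Zmodule_isLmodule.Build k (laurent k)
  laurent_scaleA laurent_scale1 laurent_scaleDr laurent_scaleDl.

Fact laurent_scaleAl (u : k) (a b : laurent k) : u *: (a * b) = (u *: a) * b.
Proof. exact: mulrA. Qed.

HB.instance Definition _ :=
  GRing.Lmodule_isLalgebra.Build k (laurent k) laurent_scaleAl.
HB.instance Definition _ := GRing.Lalgebra_isComAlgebra.Build k (laurent k).

Fact laurent_of_fps_scalable : scalable laurent_of_fps.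
Proof.
by move=> u a; rewrite -[u *: a]mul1r -scalerAr scalerAl rmorphM.
Qed.

HB.instance Definition _ :=
  GRing.isScalable.Build k (fps k) (laurent k) *:%R laurent_of_fps laurent_of_fps_scalable.

Definition fps_at0 (a : fps k) : k^o := fps_coef a 0.

Fact fps_at0_linear : linear fps_at0. Proof. by []. Qed.
Fact fps_at0_monoid : monoid_morphism fps_at0.
Proof. by split=> // a b; rewrite /fps_at0 /= big_ord1. Qed.

HB.instance Definition _ :=
  GRing.isLinear.Build k (fps k) k^o *:%R fps_at0 fps_at0_linear.
HB.instance Definition _ :=
  GRing.isMonoidMorphism.Build (fps k) k^o fps_at0 fps_at0_monoid.

Definition fps_of_scalar (u : k^o) : fps k := u%:A.

Fact fps_of_scalar_linear : linear fps_of_scalar.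
Proof. by move=> u a b; rewrite /fps_of_scalar scalerDl scalerA. Qed.
Fact fps_of_scalar_monoid : monoid_morphism fps_of_scalar.
Proof.
by split=> [|a b]; rewrite /fps_of_scalar ?scale1r // -scalerAl mul1r scalerA.
Qed.

HB.instance Definition _ :=
  GRing.isLinear.Build k k^o (fps k) *:%R fps_of_scalar fps_of_scalar_linear.
HB.instance Definition _ :=
  GRing.isMonoidMorphism.Build k^o (fps k) fps_of_scalar fps_of_scalar_monoid.

End Laurent.

Definition is_ideal (R : comPzRingType) (I : set R) : Prop :=
  [/\ I 0, forall p q, I p -> I q -> I (p + q) & forall p q, I q -> I (p * q)].

Definition zero_locus (k : closedFieldType) (n : nat) (I : set {mpoly k[n]}) :
    set ('I_n -> k) :=
  [set v | forall p, I p -> p.@[v] = 0].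

Record affvar (k : closedFieldType) := AffVar {
  av_dim : nat;
  av_set :> set ('I_av_dim -> k);
  av_closed : exists2 I, is_ideal I & av_set = zero_locus I
}.

Arguments av_set {k} a.

Definition av_pt (k : closedFieldType) (X : affvar k) : Type := set_type X.

Section CoordinateRing.
Variables (k : closedFieldType) (X : affvar k).

Definition regular : {pred (av_pt X -> k^o)} :=
  fun f => `[< exists p : {mpoly k[av_dim X]}, forall v, f v = p.@[val v] >].

Fact regular_subring : subring_closed regular.
Proof.
split=> [|f g /asboolP[p fp] /asboolP[q gq]|f g /asboolP[p fp] /asboolP[q gq]].
- by apply/asboolP; exists 1 => v; rewrite meval1.
- by apply/asboolP; exists (p - q) => v; rewrite mevalB -fp -gq.
- by apply/asboolP; exists (p * q) => v; rewrite mevalM -fp -gq.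
Qed.

Fact regular_submod : submod_closed regular.
Proof.
split=> [|u f g /asboolP[p fp] /asboolP[q gq]].
  by apply/asboolP; exists 0 => v; rewrite meval0.
by apply/asboolP; exists (u *: p + q) => v; rewrite mevalD mevalZ -fp -gq.
Qed.

HB.instance Definition _ := GRing.isSubringClosed.Build _ regular regular_subring.

(* The algebra of global sections; it is a [comPzRingType] because [X] may be
   empty. *)
Record coord_ring := CoordRing {
  cr_fun :> av_pt X -> k^o;
  cr_regular : cr_fun \in regular
}.

HB.instance Definition _ := [isSub for cr_fun].
HB.instance Definition _ := [Choice of coord_ring by <:].
HB.instance Definition _ := GRing.SubChoice_isSubComPzRing.Build
  (av_pt X -> k^o) regular coord_ring regular_subring.
HB.instance Definition _ := GRing.SubZmodule_isSubLmodule.Build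
  k (av_pt X -> k^o) regular coord_ring regular_submod.

Lemma cr_eqP (f g : coord_ring) : f =1 g <-> f = g.
Proof. by split=> [/funext|->//]; apply: val_inj. Qed.

Lemma cr_addE (f g : coord_ring) v : (f + g : coord_ring) v = f v + g v. Proof. by []. Qed.
Lemma cr_mulE (f g : coord_ring) v : (f * g : coord_ring) v = f v * g v. Proof. by []. Qed.
Lemma cr_scaleE u (f : coord_ring) v : (u *: f : coord_ring) v = u * f v. Proof. by []. Qed.
Lemma cr_oppE (f : coord_ring) v : (- f : coord_ring) v = - f v. Proof. by []. Qed.
Lemma cr_0E v : (0 : coord_ring) v = 0. Proof. by []. Qed.
Lemma cr_1E v : (1 : coord_ring) v = 1. Proof. by []. Qed.
Lemma cr_sumE I (r : seq I) (P : pred I) (F : I -> coord_ring) v :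
  (\sum_(i <- r | P i) F i) v = \sum_(i <- r | P i) F i v.
Proof. by elim/big_rec2: _ => // i a b _ <-. Qed.

Fact poly_fun_regular (p : {mpoly k[av_dim X]}) :
  (fun v : av_pt X => p.@[val v] : k^o) \in regular.
Proof. by apply/asboolP; exists p. Qed.

Definition poly_fun p : coord_ring := CoordRing (poly_fun_regular p).

Lemma poly_funE p v : poly_fun p v = p.@[val v]. Proof. by []. Qed.

End CoordinateRing.

Arguments poly_fun {k} X p.
Arguments cr_fun : simpl never.

Section Points.
Variables (k : closedFieldType) (X : affvar k).

(* [points A] is Hom(Spec A, X), given by morphisms k[X] -> A of k-algebras.
   {lrmorphism _ -> _} is not available because it requires a nonzero source. *)
Record points (A : comAlgType k) := Points {
  pts_fun :> coord_ring X -> A;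
  pts_linear : linear pts_fun;
  pts_monoid : monoid_morphism pts_fun
}.

HB.instance Definition _ (A : comAlgType k) (s : points A) :=
  GRing.isLinear.Build k (coord_ring X) A *:%R (pts_fun s) (pts_linear s).
HB.instance Definition _ (A : comAlgType k) (s : points A) :=
  GRing.isMonoidMorphism.Build (coord_ring X) A (pts_fun s) (pts_monoid s).

Lemma pointsP (A : comAlgType k) (s t : points A) : s =1 t <-> s = t.
Proof.
split=> [|->//]; case: s t => [s sl sm] [t tl tm] /= /funext st.
by rewrite st in sl sm *; congr Points; exact: Prop_irrelevance.
Qed.

Section Functoriality.
Variables (A B : comAlgType k) (f : {lrmorphism A -> B}) (s : points A).

Fact points_map_linear : linear (f \o s).
Proof. exact: linearP. Qed.
Fact points_map_monoid : monoid_morphism (f \o s).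
Proof. by split=> [|g h] /=; rewrite ?rmorph1 ?rmorphM. Qed.

Definition points_map : points B := Points points_map_linear points_map_monoid.

End Functoriality.

(* The Zariski topology on X(k) = Hom(k[X], k) *)
Definition zariski_closed : set (set (points k^o)) :=
  [set C | exists I : set (coord_ring X),
    C = [set s : points k^o | forall f, I f -> s f = 0]].

Definition zariski_closure (O : set (points k^o)) : set (points k^o) :=
  smallest zariski_closed O.

End Points.

Record morphism (k : closedFieldType) (X Y : affvar k) := Morphism {
  mor_fun :> av_pt X -> av_pt Y;
  mor_regular : forall f : coord_ring Y, f \o mor_fun \in @regular k X
}.

Section Pullback.
Variables (k : closedFieldType) (X Y : affvar k) (a : morphism X Y).

Definition pullback (f : coord_ring Y) : coord_ring X :=
  CoordRing (mor_regular a f).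

Variables (A : comAlgType k) (s : points X A).

Fact points_push_linear : linear (s \o pullback).
Proof.
move=> u f g /=; rewrite -linearP; congr (s _).
by apply/cr_eqP.
Qed.
Fact points_push_monoid : monoid_morphism (s \o pullback).
Proof.
split=> [|f g] /=; rewrite -1?(rmorph1 s) -1?rmorphM; congr (s _);
  by apply/cr_eqP.
Qed.

Definition points_push : points Y A :=
  Points points_push_linear points_push_monoid.

End Pullback.

Lemma meval_reindex (k : comNzRingType) m n (h : 'I_m -> 'I_n)
    (p : {mpoly k[m]}) (w : 'I_n -> k) :
  (mmap (@mpolyC n k) (fun i => 'X_(h i)) p).@[w] = p.@[w \o h].
Proof.
rewrite [RHS]mevalE /mmap rmorph_sum; apply: eq_bigr => q _.
rewrite rmorphM /= mevalC; congr (_ * _).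
rewrite /mmap1 rmorph_prod; apply: eq_bigr => i _.
by rewrite rmorphXn /= mevalXU.
Qed.

Section Product.
Variables (k : closedFieldType) (X Y : affvar k).

Definition prod_set : set ('I_(av_dim X + av_dim Y) -> k) :=
  [set w : 'I_(av_dim X + av_dim Y) -> k | av_set X (w \o @lshift _ _) /\
    av_set Y (w \o @rshift _ _)].

Fact prod_closed : exists2 I, is_ideal I & prod_set = zero_locus I.
Proof.
exists [set p | forall w, prod_set w -> p.@[w] = 0].
  split=> [w _|p q p0 q0 w w_in|p q q0 w w_in]; first by rewrite meval0.
    by rewrite mevalD p0 ?q0 ?addr0.
  by rewrite mevalM q0 ?mulr0.
apply/seteqP; split=> [w w_in p|w w0]; first exact.
have [I _ XE] := av_closed X; have [J _ YE] := av_closed Y.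
split; rewrite ?XE ?YE => p p0; rewrite -meval_reindex; apply: w0 => w' [].
  by rewrite meval_reindex XE => /(_ p p0).
by rewrite meval_reindex YE => _ /(_ p p0).
Qed.

Definition prod_var : affvar k := AffVar prod_closed.

Definition join (u : av_pt X) (v : av_pt Y) : 'I_(av_dim X + av_dim Y) -> k :=
  fun i => match fintype.split i with inl j => val u j | inr j => val v j end.

Fact join_prod u v : prod_set (join u v).
Proof.
split.
  rewrite [X in av_set _ X](_ : _ = val u); first exact: set_mem (valP u).
  by apply/funext => i /=; rewrite /join (unsplitK (inl i)).
rewrite [X in av_set _ X](_ : _ = val v); first exact: set_mem (valP v).
by apply/funext => i /=; rewrite /join (unsplitK (inr i)).
Qed.

Definition pair_pt (u : av_pt X) (v : av_pt Y) : av_pt prod_var :=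
  SigSub (mem_set (join_prod u v)).

End Product.

Section PairPoints.
Variables (k : closedFieldType) (X Y : affvar k) (A : comAlgType k).
Variables (s : points X A) (t : points Y A).

Let cr2 := (coord_ring X * coord_ring Y)%type.

Fact tensor_eq0_ord n (f : 'I_n -> coord_ring X) (g : 'I_n -> coord_ring Y) :
  (forall u v, \sum_(i < n) f i u * g i v = 0) ->
  \sum_(i < n) s (f i) * t (g i) = 0.
Proof.
elim: n f g => [|n IH] f g fg0; first by rewrite big_ord0.
have [[c [j cj0 cg0]]|indep] := pselect (exists c : 'I_n.+1 -> k,
    exists2 j, c j != 0 & forall v, \sum_i c i * g i v = 0).
  pose d i := - (c (lift j i) / c j).
  have gj v : g j v = \sum_(i < n) d i * g (lift j i) v.
    apply: (mulfI cj0); have := cg0 v; rewrite (bigD1_ord j) //=.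
    move/eqP; rewrite addr_eq0 => /eqP ->; rewrite mulr_sumr -sumrN.
    apply: eq_bigr => i _; rewrite mulrA mulrN mulrCA divff // mulr1.
    by rewrite mulNr.
  have {}gj' : g j = \sum_(i < n) d i *: g (lift j i).
    by apply/cr_eqP => v; rewrite gj cr_sumE.
  rewrite (bigD1_ord j) //= gj' linear_sum mulr_sumr -big_split /=.
  rewrite -[RHS](IH (fun i => d i *: f j + f (lift j i))
                    (fun i => g (lift j i))); last first.
    move=> u v; rewrite -[RHS](fg0 u v) (bigD1_ord j) //= gj.
    rewrite mulr_sumr -big_split /=; apply: eq_bigr => i _.
    by rewrite cr_addE cr_scaleE mulrDl mulrCA mulrA.
  apply: eq_bigr => i _.
  by rewrite linearD !linearZ /= mulrDl -scalerAl -scalerAr.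
apply: big1 => i _; rewrite (_ : f i = 0) ?linear0 ?mul0r //.
apply/cr_eqP => u; apply: contrapT => /eqP fu0; apply: indep.
by exists (fun i => f i u); exists i.
Qed.

(* Independence of the chosen decomposition of a function on X * Y into a sum
   of products *)
Lemma tensor_eq0 (c : seq cr2) :
  (forall u v, \sum_(p <- c) p.1 u * p.2 v = 0) ->
  \sum_(p <- c) s p.1 * t p.2 = 0.
Proof.
move=> c0; rewrite (big_nth (0, 0)) big_mkord.
apply: (@tensor_eq0_ord _ (fun i => (nth (0, 0) c i).1)
                          (fun i => (nth (0, 0) c i).2)) => u v.
by rewrite -[RHS](c0 u v) [RHS](big_nth (0, 0)) big_mkord.
Qed.

Definition decomp (F : coord_ring (prod_var X Y)) (c : seq cr2) : Prop :=
  forall u v, F (pair_pt u v) = \sum_(p <- c) p.1 u * p.2 v.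

Lemma decomp_ex F : exists c, decomp F c.
Proof.
have /asboolP[p Fp] := cr_regular F.
exists [seq (p@_m *: poly_fun X (\prod_(i < av_dim X) 'X_i ^+ m (lshift _ i)),
             poly_fun Y (\prod_(i < av_dim Y) 'X_i ^+ m (rshift _ i)))
       | m <- msupp p] => u v.
rewrite Fp mevalE [RHS]big_map; apply: eq_bigr => m _ /=.
rewrite cr_scaleE !poly_funE -mulrA; congr (_ * _); rewrite big_split_ord /=.
rewrite !rmorph_prod /=; congr (_ * _); apply: eq_bigr => i _;
  rewrite rmorphXn /= mevalXU /join.
  by rewrite (unsplitK (inl i)).
by rewrite (unsplitK (inr i)).
Qed.

Definition pair_points_fun (F : coord_ring (prod_var X Y)) : A :=
  \sum_(p <- sval (cid (decomp_ex F))) s p.1 * t p.2.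

Lemma pair_points_funE F c : decomp F c ->
  pair_points_fun F = \sum_(p <- c) s p.1 * t p.2.
Proof.
rewrite /pair_points_fun; case: cid => /= c' Fc' Fc.
pose opp (p : cr2) : cr2 := (- p.1, p.2).
have := @tensor_eq0 (c' ++ map opp c); rewrite big_cat big_map /=.
under [X in _ + X = _]eq_bigr do rewrite raddfN mulNr.
rewrite sumrN => H; apply/eqP; rewrite -subr_eq0; apply/eqP/H => u v.
rewrite big_cat big_map /= -Fc'.
under [X in _ + X]eq_bigr do rewrite cr_oppE mulNr.
by rewrite sumrN -Fc subrr.
Qed.

Fact pair_points_linear : linear pair_points_fun.
Proof.
move=> a F G; have [c Fc] := decomp_ex F; have [d Gd] := decomp_ex G.
pose sc (p : cr2) : cr2 := (a *: p.1, p.2).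
rewrite (pair_points_funE Fc) (pair_points_funE Gd).
rewrite (@pair_points_funE _ (map sc c ++ d)).
  rewrite big_cat big_map /= scaler_sumr; congr (_ + _).
  by apply: eq_bigr => p _; rewrite linearZ scalerAl.
move=> u v; rewrite big_cat big_map /= cr_addE cr_scaleE Fc Gd mulr_sumr.
by congr (_ + _); apply: eq_bigr => p _; rewrite cr_scaleE mulrA.
Qed.

Fact pair_points_monoid : monoid_morphism pair_points_fun.
Proof.
split=> [|F G].
  rewrite (@pair_points_funE _ [:: (1, 1)]) ?big_seq1 ?rmorph1 ?mulr1 //.
  by move=> u v; rewrite big_seq1 /= !cr_1E mulr1.
have [c Fc] := decomp_ex F; have [d Gd] := decomp_ex G.
rewrite (pair_points_funE Fc) (pair_points_funE Gd).
rewrite (@pair_points_funE _ [seq (p.1 * q.1, p.2 * q.2) | p <- c, q <- d]).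
  rewrite big_allpairs_dep /= mulr_suml; apply: eq_bigr => p _.
  by rewrite mulr_sumr; apply: eq_bigr => q _; rewrite !rmorphM mulrACA.
move=> u v; rewrite big_allpairs_dep /= cr_mulE Fc Gd mulr_suml.
apply: eq_bigr => p _; rewrite mulr_sumr; apply: eq_bigr => q _ /=.
by rewrite !cr_mulE mulrACA.
Qed.

(* The identification X(A) * Y(A) = (X * Y)(A) coming from
   k[X * Y] = k[X] (x) k[Y]: the function f(x) g(y) is sent to s(f) t(g). *)
Definition pair_points : points (prod_var X Y) A :=
  Points pair_points_linear pair_points_monoid.

End PairPoints.

Record alg_group (k : closedFieldType) := AlgGroup {
  ag_var :> affvar k;
  ag_mul : morphism (prod_var ag_var ag_var) ag_var;
  ag_inv : morphism ag_var ag_var;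
  ag_one : av_pt ag_var;
  ag_mulA : associative (fun g h => mor_fun ag_mul (pair_pt g h));
  ag_mul1 : left_id ag_one (fun g h => mor_fun ag_mul (pair_pt g h));
  ag_mulV : left_inverse ag_one (mor_fun ag_inv)
              (fun g h => mor_fun ag_mul (pair_pt g h))
}.

Record alg_action (k : closedFieldType) (G : alg_group k) (X : affvar k) :=
  AlgAction {
    aa_fun :> morphism (prod_var G X) X;
    aa_one : forall x, mor_fun aa_fun (pair_pt (ag_one G) x) = x;
    aa_mul : forall g h x,
      mor_fun aa_fun (pair_pt (mor_fun (ag_mul G) (pair_pt g h)) x) =
      mor_fun aa_fun (pair_pt g (mor_fun aa_fun (pair_pt h x)))
  }.

Section Action.
Variables (k : closedFieldType) (G : alg_group k) (X : affvar k).
Variables (a : alg_action G X) (A : comAlgType k).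

Definition act_points (g : points G A) (s : points X A) : points X A :=
  points_push a (pair_points g s).

Definition orbit_points (s : points X A) : set (points X A) :=
  range (act_points^~ s).

End Action.

(* Main.v *)
From HB Require Import structures.
Require Import Defs.
From mathcomp Require Import all_boot all_order all_algebra.
From mathcomp Require Import boolp classical_sets.
From mathcomp Require Import mpoly ring zify.

Set Implicit Arguments.
Unset Strict Implicit.
Unset Printing Implicit Defensive.

Import GRing.Theory.
Local Open Scope classical_set_scope.
Local Open Scope ring_scope.

(** If an arc is generically [g . x] with [g] a point of [G] over k((t)), then a
function vanishing on the orbit of [x] pulls back to zero on [G], hence vanishes
at [g . x], on the arc and at its special point.  Applied to all translates of
the special point, this is [closure_of_arc].

The converse is the statement [mpoly_laurent] about polynomials.  The orbit map
writes the coordinates of [g . x] as functions b_j on [G], and [y] being in the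
closure means that q(b) = 0 implies q(y) = 0 for every polynomial q.  A point of
[G] over k((t)) is wanted at which each b_j is a power series with constant
term y_j.

Among the ideals P that contain the ideal of [G] and for which q(b) in P still
implies q(y) = 0, take a maximal one.  It is prime; geometrically it cuts out a
closed subset of [G], as small as possible, whose image still has [y] in its
closure, and the point is that it is a curve or a point.  Let F be the fraction
field of k[G]/P.  As k is algebraically closed, [place_ex] (Chevalley's
extension theorem) provides a valuation ring O of F with residue field k at
which b_j has residue y_j.  If p generates the maximal ideal of O and every
element of F is in O after multiplication by a power of p, repeated division with
remainder in k embeds F into k((t)), mapping O into k[[t]] ([expansion_hom]).  So
it remains to prove that O is discrete ([uniformizer_ex]); when the maximal ideal
is zero, F = k and a constant arc is enough.

Each coordinate x_i on [G] or its inverse lies in O.  Together with the b_j these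
elements generate an algebra; localizing it at the maximal ideal of O gives a
noetherian local ring D with residue field k.  By maximality of P, inverting the
product b of the elements 1/x_i that were used turns D into F, so that every
nonzero element of D divides a power of b.  This forces D to have dimension at
most one ([dimension_le1]).  Indeed let z_1, ..., z_d be a smallest family in
the maximal ideal m of D whose ideal Q has radical m.  Multiplication by b is
given modulo a large power of Q by a matrix over k[z].  Its characteristic
polynomial and the lemma of Artin and Rees produce a polynomial in z whose
lowest form f, of degree j, satisfies f(z) in bD + Q^(j+1); a linear change of
the z_i turns this into z_1^j in bD + (z_i - v_i z_1 | i > 1).  A nonzero
z_i - v_i z_1 divides a power of b, so if d > 1 these d - 1 elements would be
enough.

For d = 1, D/z^n has dimension at most Nn over k if N elements span D/z.  Elements
of D with distinct values are independent, and counting them shows that z divides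
the N-th power of every element of the maximal ideal of O ([pow_mem_param]), so
that there is a smallest positive value. *)

(** * Prime ideals and their residue fields *)

(** The form of Zorn's lemma for extending a given object: unlike [Zorn_bigcup] it
asks nothing of the empty chain. *)
Lemma Zorn_above (T : Type) (good : set (set T)) (A0 : set T) :
    good A0 ->
    (forall C, C !=set0 -> C `<=` good -> total_on C subset ->
      good (\bigcup_(A in C) A)) ->
  exists A, [/\ A0 `<=` A, good A & forall B, A `<=` B -> good B -> B `<=` A].
Proof.
move=> good0 chain.
have [|A [gA maxA]] := @Zorn_bigcup T [set A | good (A0 `|` A)].
  move=> C Cgood totC; have [->|C0] := eqVneq C set0.
    by rewrite /= bigcup_set0 setU0.
  have {}C0 : C !=set0 by apply/set0P.
  rewrite /=; have -> : A0 `|` \bigcup_(A in C) A = \bigcup_(B in [set A0 `|` A | A in C]) B.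
    apply/seteqP; split=> t.
      case=> [A0t|[A CA At]]; last by exists (A0 `|` A); [exists A | right].
      by case: C0 => A CA; exists (A0 `|` A); [exists A | left].
    by case=> _ [A CA <-] [A0t|At]; [left | right; exists A].
  apply: chain.
  - by case: C0 => A CA; exists (A0 `|` A), A.
  - by move=> _ [A CA <-]; exact: Cgood.
  - move=> _ _ [A CA <-] [B CB <-].
    by have [?|?] := totC _ _ CA CB; [left|right]; apply: setUS.
exists (A0 `|` A); split=> // B AB gB.
apply: contrapT => nBA; apply: (maxA B).
  split; first by apply: subset_trans AB => t; right.
  by move=> BA; apply: nBA; apply: subset_trans BA _ => t; right.
rewrite /= (_ : A0 `|` B = B) //; apply/seteqP; split=> t; last by right.
by case=> // A0t; apply: AB; left.
Qed.

Lemma fraction_div (R : idomainType) (f : {fraction R}) :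
  exists a b, b != 0 /\ f = tofrac a / tofrac b.
Proof.
elim/quotW: f => r; have dr := denom_ratioP r.
exists (val r).1, (val r).2; split=> //.
apply: (canRL (mulfK _)); first by rewrite tofrac_eq0.
unlock FracField.tofrac; rewrite -[LHS]FracField.pi_mul; apply/eqmodP.
rewrite /= FracField.equivfE /FracField.mulf /=.
by rewrite !numden_Ratio ?(oner_neq0, mul1r, mulr1, mulf_neq0, denom_ratioP) // mulrC.
Qed.

Section Domain.
Variables (A : comNzRingType) (P : prime_idealr A).

Definition prime_quot := {ideal_quot P}.
HB.instance Definition _ := GRing.ComNzRing.on prime_quot.

Let unitr : {pred prime_quot} := fun a => `[< exists b, b * a = 1 >].
Let inv (a : prime_quot) : prime_quot :=
  if pselect (exists b, b * a = 1) is left ex then sval (cid ex) else a.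

Fact prime_quot_mulVr : {in unitr, left_inverse 1 inv *%R}.
Proof.
move=> a /asboolP exb; rewrite /inv.
by case: pselect => // ex; case: (cid ex).
Qed.

Fact prime_quot_unitPl a b : b * a = 1 -> unitr a.
Proof. by move=> ba1; apply/asboolP; exists b. Qed.

Fact prime_quot_invr_out : {in [predC unitr], inv =1 id}.
Proof.
move=> a; rewrite inE => /asboolPn nex.
by rewrite /inv; case: pselect.
Qed.

HB.instance Definition _ := GRing.ComNzRing_hasMulInverse.Build prime_quot
  prime_quot_mulVr prime_quot_unitPl prime_quot_invr_out.

HB.instance Definition _ := GRing.ComUnitRing_isIntegral.Build prime_quot
  (@Quotient.rquot_IdomainAxiom A P).

Definition prime_residue (a : A) : {fraction prime_quot} :=
  tofrac (\pi_({ideal_quot P})%qT a : prime_quot).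

Fact prime_residue_zmod : zmod_morphism prime_residue.
Proof. by move=> a b; rewrite /prime_residue !raddfB. Qed.
Fact prime_residue_monoid : monoid_morphism prime_residue.
Proof.
split; first by rewrite /prime_residue !rmorph1.
by move=> a b; rewrite /prime_residue !rmorphM.
Qed.

HB.instance Definition _ :=
  GRing.isZmodMorphism.Build A {fraction prime_quot} prime_residue
    prime_residue_zmod.
HB.instance Definition _ :=
  GRing.isMonoidMorphism.Build A {fraction prime_quot} prime_residue
    prime_residue_monoid.

Lemma prime_residue_eq0 a : (prime_residue a == 0) = (a \in P).
Proof.
rewrite /prime_residue tofrac_eq0 -(raddf0 (\pi_({ideal_quot P})%qT)).
by rewrite -Quotient.idealrBE subr0.
Qed.

Lemma prime_residue_frac f :
  exists a b, prime_residue b != 0 /\ f = prime_residue a / prime_residue b.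
Proof.
have [a [b [b0 ->]]] := fraction_div f.
exists (repr a), (repr b).
by rewrite /prime_residue !reprK tofrac_eq0.
Qed.

End Domain.

Lemma prime_ideal_field (A : comNzRingType) (P : set A) :
    P 0 -> ~ P 1 -> (forall a u v, P u -> P v -> P (a * u + v)) ->
    (forall u v, P (u * v) -> P u \/ P v) ->
  exists (F : fieldType) (h : {rmorphism A -> F}),
    (forall a, h a = 0 <-> P a) /\
    forall f, exists a b, h b != 0 /\ f = h a / h b.
Proof.
move=> P0 P1 PD Pprime; pose S : {pred A} := fun a => `[< P a >].
have idS : idealr_closed S.
  split; [exact/asboolP | exact/asboolP |].
  by move=> a u v /asboolP Pu /asboolP Pv; apply/asboolP/PD.
have prS : prime_idealr_closed S.
  by move=> u v /asboolP/Pprime[]/asboolP uS; apply/orP; [left|right].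
pose I : prime_idealr A := HB.pack S (isIdealr.Build A S idS)
  (isPrimeIdealrClosed.Build A S prS).
exists {fraction prime_quot I}, (@prime_residue A I); split=> [a|f].
  split=> [/eqP|/asboolP aP]; first by rewrite prime_residue_eq0 => /asboolP.
  by apply/eqP; rewrite prime_residue_eq0.
exact: prime_residue_frac.
Qed.

(** * Submodules and Hilbert's basis theorem *)

Section Submodules.
Variables (C : comNzRingType) (T : {pred C}).

Definition submod (M : set C) : Prop :=
  [/\ M 0, forall x y, M x -> M y -> M (x + y)
    & forall a x, a \in T -> M x -> M (a * x)].

(** The smallest submodule containing [s].  The impredicative form gives at once
the induction principle that is used on elements of a span. *)
Definition mspan (s : seq C) : set C :=
  [set x | forall M, submod M -> (forall a, a \in s -> M a) -> M x].

Definition noetherian : Prop := forall I : set C,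
  (forall x, I x -> x \in T) -> submod I ->
  exists2 s : seq C, (forall a, a \in s -> I a) & I `<=` mspan s.

Lemma submod_sum M (I : Type) (r : seq I) (P : pred I) (f : I -> C) :
  submod M -> (forall i, P i -> M (f i)) -> M (\sum_(i <- r | P i) f i).
Proof. by case=> M0 MD _ Mf; apply: big_ind. Qed.

Lemma mspan_mem s a : a \in s -> mspan s a.
Proof. by move=> sa M _; apply. Qed.

Lemma mspan_submod s : submod (mspan s).
Proof.
split=> [M [] //|x y sx sy M MM Ms|a x Ta sx M MM Ms].
  by case: (MM) => _ MD _; apply: MD; [apply: sx | apply: sy].
by case: (MM) => _ _; apply=> //; apply: sx.
Qed.

End Submodules.

Section Adjoin.
Variable C : comNzRingType.
Implicit Types (T : subringClosed C) (u : C) (s : seq C).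

Definition adjoin T u : {pred C} :=
  fun x => `[< exists2 p : {poly C}, p \is a polyOver T & x = p.[u] >].

Fact adjoin_subring T u : subring_closed (adjoin T u).
Proof.
split.
- by apply/asboolP; exists 1; rewrite ?rpred1 ?hornerC.
- move=> _ _ /asboolP[p Tp ->] /asboolP[q Tq ->]; apply/asboolP.
  by exists (p - q); rewrite ?rpredB // hornerD hornerN.
- move=> _ _ /asboolP[p Tp ->] /asboolP[q Tq ->]; apply/asboolP.
  by exists (p * q); rewrite ?rpredM // hornerM.
Qed.

HB.instance Definition _ T u :=
  GRing.isSubringClosed.Build C (adjoin T u) (adjoin_subring T u).

Lemma adjoinP T u x :
  reflect (exists2 p : {poly C}, p \is a polyOver T & x = p.[u])
    (x \in adjoin T u).
Proof. exact: asboolP. Qed.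

Lemma sub_adjoin T u x : x \in T -> x \in adjoin T u.
Proof. by move=> Tx; apply/adjoinP; exists x%:P; rewrite ?polyOverC ?hornerC. Qed.

Lemma mem_adjoin T u : u \in adjoin T u.
Proof. by apply/adjoinP; exists 'X; rewrite ?polyOverX ?hornerX. Qed.

Fixpoint adjoins T s : subringClosed C :=
  if s is u :: s' then adjoins (adjoin T u) s' else T.

Lemma sub_adjoins T s x : x \in T -> x \in adjoins T s.
Proof. by elim: s T => //= u s IH T Tx; apply/IH/sub_adjoin. Qed.

Lemma mem_adjoins T s x : x \in s -> x \in adjoins T s.
Proof.
elim: s T => //= u s IH T; rewrite inE => /predU1P[->|]; last exact: IH.
exact/sub_adjoins/mem_adjoin.
Qed.

Lemma adjoins_min T (S : subringClosed C) s :
    (forall x, x \in T -> x \in S) -> (forall x, x \in s -> x \in S) ->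
  forall x, x \in adjoins T s -> x \in S.
Proof.
elim: s T => //= u s IH T TS sS; apply: IH => x.
  case/adjoinP=> p Tp ->; rewrite horner_coef; apply: rpred_sum => i _.
  apply: rpredM; first exact/TS/(polyOverP Tp).
  by rewrite rpredX // sS // mem_head.
by move=> sx; rewrite sS // inE sx orbT.
Qed.

(** Hilbert's argument, phrased for subrings of a fixed ring so that it can be
iterated and applied inside a field or a polynomial ring without constructing
quotients.  [L n] collects the leading coefficients in degree [n] of polynomials
whose value lies in [I]. *)
Lemma hilbert_basis T u : noetherian T -> noetherian (adjoin T u).
Proof.
move=> noeT I IT subI; have [I0 ID IM] := subI.
pose L n c := exists p : {poly C},
  [/\ p \is a polyOver T, (size p <= n.+1)%N, I p.[u] & p`_n = c].
have subL n : submod T (L n).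
  split.
  - by exists 0; rewrite rpred0 size_poly0 horner0 coef0.
  - move=> _ _ [p [Tp sp Ip <-]] [q [Tq sq Iq <-]]; exists (p + q).
    rewrite rpredD // coefD hornerD; split=> //; last exact: ID.
    by rewrite (leq_trans (size_polyD _ _)) // geq_max sp.
  - move=> a _ Ta [p [Tp sp Ip <-]]; exists (a *: p); rewrite coefZ hornerZ.
    split=> //; first by rewrite polyOverZ.
      exact: leq_trans (size_scale_leq _ _) sp.
    by apply: IM => //; exact: sub_adjoin.
have LT n x : L n x -> x \in T by case=> p [/polyOverP Tp _ _ <-].
have Lmono n j c : L n c -> L (n + j)%N c.
  case=> p [Tp sp Ip <-]; exists (p * 'X^j).
  rewrite rpredM ?rpredX ?polyOverX // coefMXn addnK ltnNge leq_addl /=.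
  split=> //.
    by rewrite (leq_trans (size_polyMleq _ _)) // size_polyXn addnS /= -addSn leq_add2r.
  rewrite hornerM hornerXn mulrC; apply: IM => //.
  by rewrite rpredX // mem_adjoin.
(* [good n s] is stated with an arbitrary module [M] containing [s], so that the
   final induction on degrees can subtract polynomials with value in [M]. *)
pose good n (s : seq C) := forall M, submod (adjoin T u) M ->
  (forall a, a \in s -> M a) -> forall c, L n c ->
  exists p : {poly C}, [/\ p \is a polyOver T, (size p <= n.+1)%N,
    I p.[u], M p.[u] & p`_n = c].
have goodW n s s' : (forall a, a \in s -> a \in s') -> good n s -> good n s'.
  by move=> ss' gs M subM Ms'; apply: gs => // a /ss'/Ms'.
have gens n : exists2 s : seq C, (forall a, a \in s -> I a) & good n s.
  have [t tL Lt] := noeT _ (LT n) (subL n).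
  have [s sI sgood] : exists2 s : seq C, (forall a, a \in s -> I a) &
      forall c, c \in t -> exists p : {poly C}, [/\ p \is a polyOver T,
        (size p <= n.+1)%N, I p.[u], p.[u] \in s & p`_n = c].
    elim: t {Lt} tL => [|c t IH] tL; first by exists [::].
    have [|s sI sgood] := IH; first by move=> a ta; apply: tL; rewrite inE ta orbT.
    have [p [Tp sp Ip pc]] := tL c (mem_head _ _).
    exists (p.[u] :: s) => [a|c']; first by rewrite inE => /predU1P[->|/sI].
    rewrite inE => /predU1P[->|/sgood[q [Tq sq Iq qs qc]]].
      by exists p; rewrite mem_head.
    by exists q; rewrite inE qs orbT.
  exists s => // M subM sM c /Lt tc; have [M0 MD MM] := subM.
  apply: (tc [set c | exists p : {poly C}, [/\ p \is a polyOver T,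
    (size p <= n.+1)%N, I p.[u], M p.[u] & p`_n = c]]); last first.
    move=> a /sgood[p [Tp sp Ip sp' pa]].
    by exists p; split=> //; exact: sM.
  split.
  - by exists 0; rewrite rpred0 size_poly0 horner0 coef0.
  - move=> _ _ [p [Tp sp Ip Mp <-]] [q [Tq sq Iq Mq <-]]; exists (p + q).
    rewrite rpredD // coefD hornerD; split=> //; [|exact: ID|exact: MD].
    by rewrite (leq_trans (size_polyD _ _)) // geq_max sp.
  - move=> a _ Ta [p [Tp sp Ip Mp <-]]; exists (a *: p); rewrite coefZ hornerZ.
    split=> //; first by rewrite polyOverZ.
    + exact: leq_trans (size_scale_leq _ _) sp.
    + by apply: IM => //; exact: sub_adjoin.
    + by apply: MM => //; exact: sub_adjoin.
(* Generators of the union of the increasing [L n] already occur in some [L N];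
   beyond degree N a leading coefficient is obtained by multiplying by 'X^j. *)
have [N LN] : exists N, forall n c, L n c -> L N c.
  have [||t tL Lt] := noeT [set c | exists n, L n c].
  - by move=> x [n /LT].
  - split=> [|x y [n Lx] [n' Ly]|a x Ta [n Lx]].
    + by exists 0%N; case: (subL 0%N).
    + exists (n + n')%N; case: (subL (n + n')%N) => _ LD _; apply: LD.
        exact: Lmono.
      by rewrite addnC; exact: Lmono.
    + by exists n; case: (subL n) => _ _; apply.
  have [N tN] : exists N, forall c, c \in t -> L N c.
    elim: t {Lt} tL => [|c t IH] tL; first by exists 0%N.
    have [|N tN] := IH; first by move=> a ta; apply: tL; rewrite inE ta orbT.
    have [n Lc] := tL c (mem_head _ _); exists (n + N)%N => c'.
    rewrite inE => /predU1P[->|/tN]; first exact: Lmono.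
    by rewrite addnC; exact: Lmono.
  by exists N => n c Lc; apply: (Lt c) => //; exists n.
have [s sI sgood] : exists2 s : seq C, (forall a, a \in s -> I a) &
    forall n, (n <= N)%N -> good n s.
  elim: N {LN} => [|N [s sI sgood]].
    by have [s sI sgood] := gens 0%N; exists s => // n; rewrite leqn0 => /eqP ->.
  have [s' s'I s'good] := gens N.+1; exists (s ++ s') => [a|n].
    by rewrite mem_cat => /orP[/sI|/s'I].
  rewrite leq_eqVlt => /predU1P[->|nN].
    by apply: goodW s'good => a s'a; rewrite mem_cat s'a orbT.
  by apply: goodW (sgood n nN) => a sa; rewrite mem_cat sa.
exists s => // x Ix M subM sM; have [M0 MD MM] := subM.
have /adjoinP[p Tp xp] := IT _ Ix; rewrite {x}xp in Ix *.
have [n sp] : exists n, (size p <= n)%N by exists (size p).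
elim: n p sp Tp Ix => [|n IH] p sp Tp Ip.
  by move: sp; rewrite leqn0 size_poly_eq0 => /eqP ->; rewrite horner0.
have [q [Tq sq Iq Mq pq]] : exists q : {poly C}, [/\ q \is a polyOver T,
    (size q <= n.+1)%N, I q.[u], M q.[u] & q`_n = p`_n].
  have Lp : L n p`_n by exists p.
  have [nN|Nn] := leqP n N; first exact: (sgood n nN M subM sM).
  have [q [Tq sq Iq Mq qp]] := sgood N (leqnn _) M subM sM _ (LN _ _ Lp).
  exists (q * 'X^(n - N)); rewrite hornerM hornerXn [q.[u] * _]mulrC.
  have uT : u ^+ (n - N) \in adjoin T u by rewrite rpredX // mem_adjoin.
  split; [by rewrite rpredM ?rpredX ?polyOverX| |exact: IM|exact: MM|].
    rewrite (leq_trans (size_polyMleq _ _)) // size_polyXn addnS /=.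
    by rewrite (leq_trans (leq_add sq (leqnn _))) // addSn subnKC // ltnW.
  by rewrite coefMXn ltnNge leq_subr /= subKn // ltnW.
rewrite -[p](subrK q) hornerD; apply: MD => //; apply: IH.
- apply/leq_sizeP => j; rewrite leq_eqVlt => /predU1P[<-|nj].
    by rewrite coefB pq subrr.
  by rewrite coefB !nth_default ?subrr // (leq_trans _ nj).
- by rewrite rpredB.
- rewrite hornerD hornerN; apply: ID => //; rewrite -mulN1r; apply: IM => //.
  by rewrite rpredN rpred1.
Qed.

Lemma noetherian_adjoins T s : noetherian T -> noetherian (adjoins T s).
Proof. by elim: s T => //= u s IH T noeT; apply/IH/hilbert_basis. Qed.

End Adjoin.

(** * Polynomials in several variables *)

Lemma mpoly_ring_ind (R : comNzRingType) n (P : {mpoly R[n]} -> Prop) :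
    (forall c, P c%:MP) -> (forall i, P 'X_i) ->
    (forall p q, P p -> P q -> P (p + q)) ->
    (forall p q, P p -> P q -> P (p * q)) ->
  forall p, P p.
Proof.
move=> PC PX PD PM; elim/mpolyind => [|c m p _ _ Pp]; first by rewrite -mpolyC0.
apply: (PD) => //; rewrite -mul_mpolyC; apply: (PM) => //.
rewrite mpolyXE_id; elim/big_rec: _ => [|i q _ Pq]; first exact: (PC 1).
apply: (PM) => //; elim: (m i) => [|j IH]; first exact: (PC 1).
by rewrite exprS; apply: PM.
Qed.

Lemma base_inj B n (a b : 'I_n -> nat) :
    (forall i, a i < B)%N -> (forall i, b i < B)%N ->
    (\sum_i a i * B ^ i = \sum_i b i * B ^ i)%N -> a =1 b.
Proof.
elim: n a b => [|n IH] a b aB bB; first by move=> _ [].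
have split0 (c : 'I_n.+1 -> nat) : (\sum_i c i * B ^ i =
    (\sum_(i < n) c (lift ord0 i) * B ^ i) * B + c ord0)%N.
  rewrite big_ord_recl expn0 muln1 addnC big_distrl; congr addn.
  by apply: eq_bigr => i _; rewrite /= /bump /= expnSr mulnA.
rewrite !split0 => eqs; have B0 : (0 < B)%N by apply: leq_ltn_trans (aB ord0).
have e0 : a ord0 = b ord0.
  by have := congr1 (modn^~ B) eqs; rewrite /= !modnMDl !modn_small.
move=> i; case: (unliftP ord0 i) => [j|] -> //.
apply: (IH (a \o lift ord0) (b \o lift ord0)) => [l|l|]; rewrite /= ?aB ?bB //.
by apply/eqP; rewrite -(eqn_pmul2r B0) -(eqn_add2r (a ord0)) {2}e0 eqs.
Qed.

(** Kronecker substitution: the variables are replaced by the powers t^(B^i), with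
B larger than all exponents, so that distinct monomials become distinct powers
of t; then [base_inj] reduces the claim to one variable.  Nonzero coordinates are
needed for dehomogenizing. *)
Lemma mpoly_nonroot (k : closedFieldType) n (p : {mpoly k[n]}) : p != 0 ->
  exists2 v : 'I_n -> k, p.@[v] != 0 & forall i, v i != 0.
Proof.
move=> p0; pose B := (msize p).+1; pose w (m : 'X_{1..n}) := (\sum_i m i * B ^ i)%N.
have small m i : m \in msupp p -> (m i < B)%N.
  move=> /msize_mdeg_lt mp; rewrite ltnS (leq_trans _ (ltnW mp)) //.
  by rewrite mdegE (bigD1 i) //= leq_addr.
have winj : {in msupp p &, injective w}.
  move=> m m' mp m'p wm; apply/mnmP/(base_inj (B := B)) => // i; exact: small.
pose q := \sum_(m <- msupp p) p@_m *: 'X^(w m).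
have q0 : q != 0.
  apply/eqP => /(congr1 (fun r : {poly k} => r`_(w (mlead p)))) /eqP.
  rewrite coef0 coef_sum (bigD1_seq (mlead p)) ?msupp_uniq ?mlead_supp //=.
  rewrite coefZ coefXn eqxx mulr1 big_seq_cond big1 ?addr0.
    by rewrite mleadc_eq0 (negbTE p0).
  move=> m /andP[mp mn]; rewrite coefZ coefXn; case: eqP => [/winj mm|]; last by rewrite mulr0.
  by move: mn; rewrite mm ?eqxx // mlead_supp.
have /closed_nonrootP[t] : q * 'X != 0 by rewrite mulf_neq0 // polyX_eq0.
rewrite /root hornerM hornerX mulf_eq0 negb_or => /andP[qt t0].
exists (fun i : 'I_n => t ^+ (B ^ i)) => [|i]; last by rewrite expf_neq0.
suff -> : p.@[fun i : 'I_n => t ^+ (B ^ i)] = q.[t] by [].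
rewrite mevalE horner_sum; apply: eq_bigr => m _.
rewrite hornerZ hornerXn; congr (_ * _); rewrite -prodrXr.
by apply: eq_bigr => i _; rewrite -exprM mulnC.
Qed.

Section Submodules.
Variables (R C : comNzRingType) (h : {rmorphism R -> C}) (T : subringClosed C).
Hypothesis Th : forall c, h c \in T.

Lemma mmap_mem n (v : 'I_n -> C) p : (forall i, v i \in T) -> mmap h v p \in T.
Proof.
move=> Tv; elim/mpoly_ring_ind: p => [c|i|p q Tp Tq|p q Tp Tq].
- by rewrite mmapC; exact: Th.
- by rewrite mmapX mmap1U.
- by rewrite rmorphD rpredD.
- by rewrite rmorphM rpredM.
Qed.

Lemma mmap_congr M n (u v : 'I_n -> C) p : submod T M ->
    (forall i, u i \in T) -> (forall i, v i \in T) ->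
  (forall i, M (u i - v i)) -> M (mmap h u p - mmap h v p).
Proof.
move=> [M0 MD MM] Tu Tv uv; elim/mpoly_ring_ind: p => [c|i|p q Mp Mq|p q Mp Mq].
- by rewrite !mmapC subrr.
- by rewrite !mmapX !mmap1U.
- by rewrite !rmorphD opprD addrACA; apply: MD.
- rewrite !rmorphM; have -> (a b c d : C) : a * b - c * d = a * (b - d) + d * (a - c).
    by rewrite !mulrBr [d * a]mulrC [d * c]mulrC addrA subrK.
  by apply: MD; apply: MM => //; apply: mmap_mem.
Qed.

End Submodules.

Lemma mmap_id (k : comNzRingType) n (v : 'I_n -> k) p :
  mmap idfun v p = p.@[v].
Proof. by []. Qed.

Lemma mmap_comp (R S C : comNzRingType) (h : {rmorphism R -> S})
    (g : {rmorphism S -> C}) n (v : 'I_n -> S) p :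
  g (mmap h v p) = mmap (g \o h) (g \o v) p.
Proof.
elim/mpoly_ring_ind: p => [c|i|p q Ep Eq|p q Ep Eq].
- by rewrite !mmapC.
- by rewrite !mmapX !mmap1U.
- by rewrite !rmorphD Ep Eq.
- by rewrite !rmorphM Ep Eq.
Qed.

(** * Spans, powers of an ideal and characteristic polynomials *)

Section Scalars.
Variables (k : fieldType) (C : comNzRingType) (h : {rmorphism k -> C}).

Definition scalars : {pred C} := fun x => `[< exists c, x = h c >].

Lemma scalarsP x : reflect (exists c, x = h c) (x \in scalars).
Proof. exact: asboolP. Qed.

Fact scalars_subring : subring_closed scalars.
Proof.
split.
- by apply/scalarsP; exists 1; rewrite rmorph1.
- move=> _ _ /scalarsP[a ->] /scalarsP[b ->]; apply/scalarsP.
  by exists (a - b); rewrite rmorphB.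
- move=> _ _ /scalarsP[a ->] /scalarsP[b ->]; apply/scalarsP.
  by exists (a * b); rewrite rmorphM.
Qed.

HB.instance Definition _ :=
  GRing.isSubringClosed.Build C scalars scalars_subring.

Lemma mem_scalars c : h c \in scalars.
Proof. by apply/scalarsP; exists c. Qed.

Lemma noetherian_scalars : noetherian scalars.
Proof.
move=> I IK subI; have [[c c0 Ic]|I0] := pselect (exists2 c, c != 0 & I (h c)).
  exists [:: h c] => [a|x Ix M [M0 MD MM] Ms]; first by rewrite inE => /eqP ->.
  have /scalarsP[e ->] := IK _ Ix; rewrite -[e](divfK c0) rmorphM.
  by apply: MM; [exact: mem_scalars | apply: Ms; rewrite mem_head].
exists [::] => // x Ix M [M0 _ _] _; have /scalarsP[e xe] := IK _ Ix.
have [e0|e0] := eqVneq e 0; first by rewrite xe e0 rmorph0.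
by case: I0; exists e => //; rewrite -xe.
Qed.

Lemma adjoins_mmap n (v : 'I_n -> C) x :
  x \in adjoins (scalars : subringClosed C) [seq v i | i <- enum 'I_n] ->
  exists p, x = mmap h v p.
Proof.
pose img : {pred C} := fun x => `[< exists p, x = mmap h v p >].
have img_sub : subring_closed img.
  split.
  - by apply/asboolP; exists 1; rewrite rmorph1.
  - move=> _ _ /asboolP[p ->] /asboolP[q ->]; apply/asboolP.
    by exists (p - q); rewrite rmorphB.
  - move=> _ _ /asboolP[p ->] /asboolP[q ->]; apply/asboolP.
    by exists (p * q); rewrite rmorphM.
pose S : subringClosed C := HB.pack img (GRing.isSubringClosed.Build C img img_sub).
move=> xs; suff : x \in S by move/asboolP.
apply: adjoins_min xs => y => [/scalarsP[c ->]|/mapP[i _ ->]]; apply/asboolP.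
  by exists c%:MP; rewrite mmapC.
by exists 'X_i; rewrite mmapX mmap1U.
Qed.

End Scalars.

Lemma mspan_coord (C : comNzRingType) (T : subringClosed C) (s : seq C) x :
  mspan T s x -> exists2 c : 'I_(size s) -> C,
    forall i, c i \in T & x = \sum_i c i * s`_i.
Proof.
pose L := [set y | exists2 c : 'I_(size s) -> C,
  forall i, c i \in T & y = \sum_i c i * s`_i].
move=> sx; apply: (sx L); first split.
- exists (fun=> 0) => [i|]; first exact: rpred0.
  by rewrite big1 // => i _; rewrite mul0r.
- move=> _ _ [c Tc ->] [e Te ->]; exists (fun i => c i + e i) => [i|].
    exact: rpredD.
  by rewrite -big_split; apply: eq_bigr => i _; rewrite mulrDl.
- move=> a _ Ta [c Tc ->]; exists (fun i => a * c i) => [i|]; first exact: rpredM.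
  by rewrite mulr_sumr; apply: eq_bigr => i _; rewrite mulrA.
- move=> a /(nthP 0)[j js <-].
  exists (fun i => (val i == j)%:R) => [i|]; first exact: rpred_nat.
  rewrite (bigD1 (Ordinal js)) //= eqxx mul1r big1 ?addr0 // => i.
  by rewrite -val_eqE /= => /negbTE ->; rewrite mul0r.
Qed.

Lemma choice2 (S U : Type) (P Q : S -> U -> Prop) :
    (forall x, exists2 y, P x y & Q x y) ->
  exists2 f, forall x, P x (f x) & forall x, Q x (f x).
Proof.
move=> PQ; have /choice[f fP] x : exists y, P x y /\ Q x y.
  by have [y Py Qy] := PQ x; exists y.
by exists f => x; case: (fP x).
Qed.

Section IdealPowers.
Variables (F : comNzRingType) (D : subringClosed F).

(** The J-th power of the ideal generated by the [z i] in [D], defined by expansion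
along the generators: this is the form in which elements are divided out below. *)
Fixpoint idpow d (z : 'I_d -> F) J : set F :=
  if J is J'.+1 then
    [set x | exists y : 'I_d -> F,
      (forall i, idpow z J' (y i)) /\ x = \sum_i z i * y i]
  else [set x | x \in D].

Lemma idpowSP d (z : 'I_d -> F) J x : idpow z J.+1 x <->
  exists y, (forall i, idpow z J (y i)) /\ x = \sum_i z i * y i.
Proof. by []. Qed.

Variables (d : nat) (z : 'I_d -> F).
Hypothesis zD : forall i, z i \in D.

Lemma idpow_submod J : submod D (idpow z J).
Proof.
elim: J => [|J [IH0 IHD IHM]] /=.
  by split=> [|x y xD yD|a x aD xD] /=; [exact: rpred0|exact: rpredD|exact: rpredM].
split.
- by exists (fun=> 0); split=> //; rewrite big1 // => i _; rewrite mulr0.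
- move=> _ _ [y [yJ ->]] [y' [y'J ->]]; exists (fun i => y i + y' i).
  split=> [i|]; first exact: IHD.
  by rewrite -big_split; apply: eq_bigr => i _; rewrite mulrDr.
- move=> a _ aD [y [yJ ->]]; exists (fun i => a * y i).
  split=> [i|]; first exact: IHM.
  by rewrite mulr_sumr; apply: eq_bigr => i _; rewrite mulrCA.
Qed.

Lemma idpowD J x y : idpow z J x -> idpow z J y -> idpow z J (x + y).
Proof. by case: (idpow_submod J) => _ + _; apply. Qed.

Lemma idpowMl J a x : a \in D -> idpow z J x -> idpow z J (a * x).
Proof. by case: (idpow_submod J) => _ _; apply. Qed.

Lemma idpow0 J : idpow z J 0.
Proof. by case: (idpow_submod J). Qed.

Lemma idpowN J x : idpow z J x -> idpow z J (- x).
Proof. by move=> xJ; rewrite -mulN1r; apply: idpowMl => //; rewrite rpredN rpred1. Qed.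

Lemma idpow_gen J i x : idpow z J x -> idpow z J.+1 (z i * x).
Proof.
move=> xJ; exists (fun j => if j == i then x else 0); split.
  by move=> j; case: eqP => _ //; apply: idpow0.
by rewrite (bigD1 i) //= eqxx big1 ?addr0 // => j /negbTE ->; rewrite mulr0.
Qed.

Lemma idpow_sum J (I : Type) (r : seq I) (P : pred I) (f : I -> F) :
  (forall i, P i -> idpow z J (f i)) -> idpow z J (\sum_(i <- r | P i) f i).
Proof. by move=> fJ; apply: submod_sum fJ; apply: idpow_submod. Qed.

Lemma idpowS J x : idpow z J.+1 x -> idpow z J x.
Proof.
by move=> /idpowSP[y [yJ ->]]; apply: idpow_sum => i _; apply: idpowMl.
Qed.

Lemma idpow_le I J x : (I <= J)%N -> idpow z J x -> idpow z I x.
Proof.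
by move=> /subnK <-; elim: (J - I)%N => // n IH; rewrite addSn => /idpowS.
Qed.

Lemma idpow_mem J x : idpow z J x -> x \in D.
Proof. exact: (idpow_le (leq0n J)). Qed.

Lemma idpowM I J x y : idpow z I x -> idpow z J y -> idpow z (I + J) (x * y).
Proof.
elim: I x => [|I IH] x; first by move=> xD yJ; apply: idpowMl.
move=> /idpowSP[u [uI ->]] yJ; rewrite mulr_suml addSn; apply: idpow_sum => i _.
by rewrite -mulrA; apply: idpow_gen; apply: IH.
Qed.

Lemma idpow1_min M x : submod D M -> (forall i, M (z i)) -> idpow z 1 x -> M x.
Proof.
move=> subM Mz /idpowSP[y [yD ->]]; have [_ _ MM] := subM.
apply: (submod_sum _ subM) => i _.
by rewrite mulrC; apply: MM => //; exact: yD.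
Qed.

Lemma mem_idpow1 i : idpow z 1 (z i).
Proof. by rewrite -[z i]mulr1; apply: idpow_gen; exact: rpred1. Qed.

End IdealPowers.

Lemma mspan_sub (C : comNzRingType) (T : {pred C}) (s s' : seq C) x :
  (forall a, a \in s -> mspan T s' a) -> mspan T s x -> mspan T s' x.
Proof. by move=> ss' sx; apply: sx => //; exact: mspan_submod. Qed.

Lemma det_mem (C : comNzRingType) (S : subringClosed C) n (A : 'M[C]_n) :
  (forall i j, A i j \in S) -> \det A \in S.
Proof.
move=> AS; rewrite /determinant; apply: rpred_sum => s _.
by rewrite rpredM ?rpredX ?rpredN ?rpred1 // rpred_prod.
Qed.

Lemma char_poly_over (C : comNzRingType) (S : subringClosed C) n (A : 'M[C]_n) :
  (forall i j, A i j \in S) -> char_poly A \is a polyOver S.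
Proof.
move=> AS; apply: det_mem => i j; rewrite !mxE rpredB ?polyOverC //.
by rewrite rpredMn // polyOverX.
Qed.

Lemma horner_char_poly (C : comNzRingType) n (A : 'M[C]_n) b :
  (char_poly A).[b] = \det (b%:M - A).
Proof.
rewrite -[LHS]/(horner_eval b _) /char_poly -det_map_mx; congr (\det _).
apply/matrixP => i j; rewrite !mxE /= /horner_eval hornerD hornerN hornerC hornerMn.
by rewrite hornerX.
Qed.

Lemma mmap1_scale (C : comNzRingType) d (t : C) (v : 'I_d -> C) mon :
  mmap1 (fun i => t * v i) mon = t ^+ mdeg mon * mmap1 v mon.
Proof.
rewrite mdegE /mmap1 -prodrXr -big_split; apply: eq_bigr => i _.
by rewrite exprMn.
Qed.

(** * The lemma of Artin and Rees *)

(** In this section [D] is a local ring with maximal ideal [m] and residue field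
[k], obtained from the algebra generated by [gam] by inverting the elements
outside [m]. *)
Section LocalRing.
Variables (k : closedFieldType) (F : fieldType) (emb : {rmorphism k -> F}).
Variables (gam : seq F) (D : subringClosed F) (m : set F).

Let K : subringClosed F := scalars emb.
Let T := adjoins K gam.

Hypothesis TD : forall x, x \in T -> x \in D.
Hypothesis DT : forall x, x \in D -> exists2 s, s \in T /\ ~ m s & s * x \in T.
Hypothesis msub : submod D m.
Hypothesis mD : forall x, m x -> x \in D.
Hypothesis m1 : ~ m 1.
Hypothesis Dloc : forall x, x \in D -> ~ m x -> x^-1 \in D.
Hypothesis Dres : forall x, x \in D -> exists c, m (x - emb c).
Hypothesis mgam : forall a, a \in gam -> m a.
Hypothesis mgen : forall x, m x -> mspan D gam x.

Lemma embD c : emb c \in D.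
Proof. by apply/TD/sub_adjoins/mem_scalars. Qed.

#[local] Hint Resolve embD : core.

Lemma m0 : m 0. Proof. by case: msub. Qed.

Lemma notin_m_neq0 s : ~ m s -> s != 0.
Proof. by move=> ms; apply/eqP => s0; apply: ms; rewrite s0; exact: m0. Qed.

Lemma notin_mM s t : s \in D -> ~ m s -> ~ m t -> ~ m (s * t).
Proof.
move=> sD ms mt mst; apply: mt; rewrite -[t](mulKf (notin_m_neq0 ms)).
by case: msub => _ _; apply=> //; apply: Dloc.
Qed.

(** The Rees algebra of the ideal [z] is represented, up to denominators, by the
subalgebra of F[U] generated by the elements of [gam] and the z_i U. *)
Lemma rees_const x : x \in T -> forall s, 
  x%:P \in adjoins (scalars (polyC \o emb) : subringClosed {poly F}) ([seq g%:P | g <- gam] ++ s).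
Proof.
move=> xT s; set TT := adjoins _ _.
pose S0 : {pred F} := fun x => x%:P \in TT.
have S0sub : subring_closed S0.
  split=> [|a b aS bS|a b aS bS]; rewrite unfold_in; first exact: rpred1.
    by rewrite polyCB rpredB.
  by rewrite polyCM rpredM.
pose S : subringClosed F := HB.pack S0 (GRing.isSubringClosed.Build F S0 S0sub).
suff : x \in S by [].
apply: adjoins_min xT => a => [/scalarsP[c ->]|ga]; rewrite unfold_in.
  by apply/sub_adjoins/scalarsP; exists c.
by apply: mem_adjoins; rewrite mem_cat map_f.
Qed.

(** The multiples of [b] in the Rees algebra form a finitely generated ideal.  If
the degrees of its generators are less than [c], an element b y of the J-th power
is a combination of b times elements of D with coefficients in the powers at
least J - c, and [b] can be cancelled. *)
Lemma artin_rees d (z : 'I_d -> F) (b : F) : (forall i, z i \in D) -> b != 0 ->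
  forall J', exists J, forall y, y \in D -> idpow D z J (b * y) -> idpow D z J' y.
Proof.
move=> zD b0; pose sz := [seq (z i)%:P * 'X | i <- enum 'I_d].
pose TT := adjoins (scalars (polyC \o emb) : subringClosed {poly F})
  ([seq g%:P | g <- gam] ++ sz).
have TTcoef f : f \in TT -> forall l, idpow D z l f`_l.
  pose S0 : {pred {poly F}} := fun f => `[< forall l, idpow D z l f`_l >].
  have S0sub : subring_closed S0.
    split.
    - apply/asboolP => l; rewrite coef1; case: eqP => [->|_]; first exact: rpred1.
      exact: idpow0.
    - move=> p q /asboolP Sp /asboolP Sq; apply/asboolP => l; rewrite coefB.
      by apply: idpowD => //; apply: idpowN.
    - move=> p q /asboolP Sp /asboolP Sq; apply/asboolP => l; rewrite coefM.
      apply: idpow_sum => // i _; rewrite -{1}(subnKC (ltn_ord i : (i <= l)%N)).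
      exact: idpowM.
  pose S : subringClosed {poly F} :=
    HB.pack S0 (GRing.isSubringClosed.Build {poly F} S0 S0sub).
  move=> fT; suff : f \in S by move/asboolP.
  apply: adjoins_min fT => g => [/scalarsP[c ->]|].
    apply/asboolP => l /=; rewrite coefC; case: eqP => [->|_].
      exact: embD.
    exact: idpow0.
  rewrite mem_cat => /orP[/mapP[a ga ->]|/mapP[i _ ->]]; apply/asboolP => l.
    by rewrite coefC; case: eqP => [->|_]; [exact/mD/mgam | exact: idpow0].
  rewrite coefCM coefX; case: eqP => [->|_]; first by rewrite mulr1; exact: mem_idpow1.
  by rewrite mulr0; exact: idpow0.
(* Every element of the J-th power occurs in degree J of the Rees algebra after
   multiplication by a unit of D. *)
have lift x J : idpow D z J x ->
    exists2 s, s \in T /\ ~ m s & (s * x)%:P * 'X^J \in TT.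
  elim: J x => [|J IH] x.
    move=> /DT[s Ts sx]; exists s => //; rewrite expr0 mulr1.
    exact: rees_const.
  move=> /idpowSP[y [yJ ->]].
  elim/big_rec: _ => [|i x' _ [s [sT ms] sx]].
    by exists 1; [split=> //; exact: rpred1 | rewrite mulr0 mul0r rpred0].
  have [t [tT mt] ty] := IH _ (yJ i).
  exists (s * t); first by split; [exact: rpredM | apply: notin_mM => //; exact: TD].
  rewrite mulrDr polyCD mulrDl; apply: rpredD; last first.
    by rewrite [s * t]mulrC -mulrA polyCM -mulrA rpredM // rees_const.
  have -> : ((s * t * (z i * y i))%:P * 'X^(J.+1) : {poly F}) =
      (s%:P * ((z i)%:P * 'X) * ((t * y i)%:P * 'X^J) : {poly F}).
    by rewrite exprS !polyCM; ring.
  rewrite rpredM // rpredM ?rees_const //.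
  by apply: mem_adjoins; rewrite mem_cat; apply/orP; right; apply: map_f; rewrite mem_enum.
pose I f := f \in TT /\ forall l, exists2 y, y \in D & f`_l = b * y.
have noeTT : noetherian TT by apply/noetherian_adjoins/noetherian_scalars.
have [||gs gsI Igs] := noeTT I; first by move=> f [].
  split.
  - by split=> [|l]; [exact: rpred0 | exists 0; rewrite ?rpred0 // coef0 mulr0].
  - move=> f g [fT fb] [gT gb]; split=> [|l]; first exact: rpredD.
    have [[y yD fy] [y' y'D gy]] := (fb l, gb l).
    by exists (y + y'); rewrite ?rpredD // coefD fy gy mulrDr.
  - move=> f g fT [gT gb]; split=> [|l]; first exact: rpredM.
    have [y yP gy] := choice2 gb.
    exists (\sum_(i < l.+1) f`_i * y (l - i)%N).
      apply: rpred_sum => i _; apply: rpredM; last exact: yP.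
      exact: idpow_mem (TTcoef _ fT i).
    by rewrite coefM mulr_sumr; apply: eq_bigr => i _; rewrite gy mulrCA.
have [c gsc] : exists c, forall g, g \in gs -> (size g <= c)%N.
  exists (\max_(g <- gs) size g)%N => g gg.
  exact: (@leq_bigmax_seq _ gs predT (fun g : {poly F} => size g)).
have key f : I f -> forall l, exists2 y, idpow D z (l - c) y & f`_l = b * y.
  pose L := [set g : {poly F} |
    forall l, exists2 y, idpow D z (l - c) y & g`_l = b * y].
  move=> /Igs fs; apply: (fs L); first split.
  - by move=> l; exists 0; [exact: idpow0 | rewrite coef0 mulr0].
  - move=> f' g fb gb l; have [[y yD fy] [y' y'D gy]] := (fb l, gb l).
    by exists (y + y'); [exact: idpowD | rewrite coefD fy gy mulrDr].
  - move=> f' g f'T gb l.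
    have [y yP gy] := choice2 gb.
    exists (\sum_(i < l.+1) f'`_i * y (l - i)%N).
      apply: idpow_sum => // i _; have yi := yP (l - i)%N.
      apply: (idpow_le zD _ (idpowM (TTcoef _ f'T i) yi)).
      by have := ltn_ord i; lia.
    by rewrite coefM mulr_sumr; apply: eq_bigr => i _; rewrite gy mulrCA.
  - move=> g gg l; have [cl|lc] := leqP c l.
      exists 0; first exact: idpow0.
      by rewrite nth_default ?mulr0 // (leq_trans (gsc _ gg)).
    have [_ /(_ l)[y yD gy]] := gsI _ gg; exists y => //.
    by move: lc => /ltnW; rewrite -subn_eq0 => /eqP ->.
move=> J'; exists (J' + c)%N => y yD byJ.
have [s [sT ms] sby] := lift _ _ byJ; have sD := TD sT.
have If : I ((s * (b * y))%:P * 'X^(J' + c)).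
  split=> // l; rewrite coefCM coefXn; case: eqP => _.
    by exists (s * y); rewrite ?rpredM // mulr1 mulrCA.
  by exists 0; rewrite ?rpred0 // !mulr0.
have [y' y'J] := key _ If (J' + c)%N.
rewrite coefCM coefXn eqxx mulr1 addnK in y'J *.
rewrite mulrCA => /(mulfI b0) sy.
by rewrite -[y](mulKf (notin_m_neq0 ms)) sy; apply: idpowMl => //; apply: Dloc.
Qed.

(** * The dimension of a local ring *)

(** Systems of parameters, except that [d] need not be minimal. *)
Definition params d (z : 'I_d -> F) : Prop :=
  (forall i, m (z i)) /\ forall x, m x -> exists M, idpow D z 1 (x ^+ M).

Section Params.
Variables (d : nat) (z : 'I_d -> F).
Hypothesis zP : params z.

Let zD i : z i \in D. Proof. by apply/mD; case: zP. Qed.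

(** Since D = k + m, the generators in [gam] of [m] can be eliminated one after
the other: if D is spanned over k modulo a and the remaining ones, and a^n lies
in the ideal of [z], the products of a^i (i < n) with the spanning elements
suffice without a. *)
Lemma finite_mod_params : exists N (e : 'I_N -> F), (forall i, e i \in D) /\
  forall x, x \in D -> exists c : 'I_N -> k,
    idpow D z 1 (x - \sum_i emb (c i) * e i).
Proof.
pose good (s : seq F) := exists2 e : seq F, (forall a, a \in e -> a \in D) &
  forall M, submod D M -> idpow D z 1 `<=` M -> (forall a, a \in s -> M a) ->
  forall x, x \in D -> exists2 y, mspan K e y & M (x - y).
have good_gam : good gam.
  exists [:: 1] => [a|M subM _ Mgam x xD]; first by rewrite inE => /eqP ->; exact: rpred1.
  have [c xc] := Dres xD; exists (emb c); last exact: (mgen xc).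
  move=> M' [_ _ MM] M1; rewrite -[emb c]mulr1; apply: MM; first exact: mem_scalars.
  by apply: M1; rewrite mem_head.
have good_step a s : m a -> good (a :: s) -> good s.
  move=> ma [e eD eP]; have [n an] := zP.2 _ ma; have aD := mD ma.
  pose E j := [seq a ^+ i * t | i <- iota 0 j, t <- e].
  exists (E n) => [_ /allpairsP[[i t] /= [_ te ->]]|M subM QM Ms x xD].
    by rewrite rpredM ?rpredX // eD.
  have [M0 MD MM] := subM.
  pose M' : set F := [set u | exists v w, [/\ M v, w \in D & u = v + a * w]].
  have subM' : submod D M'.
    split; first by exists 0, 0; rewrite mulr0 addr0 rpred0.
      move=> _ _ [v [w [Mv wD ->]]] [v' [w' [Mv' w'D ->]]]; exists (v + v'), (w + w').
      by rewrite rpredD // mulrDr addrACA; split=> //; exact: MD.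
    move=> c _ cD [v [w [Mv wD ->]]]; exists (c * v), (c * w).
    by rewrite rpredM // mulrDr [a * (c * w)]mulrCA; split=> //; exact: MM.
  have step w : w \in D -> exists2 y, mspan K e y & M' (w - y).
    apply: (eP _ subM') => [u /QM Mu|u].
      by exists u, 0; rewrite mulr0 addr0 rpred0.
    rewrite inE => /predU1P[->|/Ms Mu].
      by exists 0, 1; rewrite mulr1 add0r rpred1.
    by exists u, 0; rewrite mulr0 addr0 rpred0.
  have iter j : exists2 y, mspan K (E j) y &
      exists v w, [/\ M v, w \in D & x - y = v + a ^+ j * w].
    elim: j => [|j [y Ey [v [w [Mv wD xy]]]]].
      exists 0; first by move=> M'' [].
      by exists 0, x; rewrite expr0 mul1r subr0 add0r.
    have [y' ey' [v' [w' [Mv' w'D wy']]]] := step w wD.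
    have EjS : E j.+1 = E j ++ [seq a ^+ j * t | t <- e].
      rewrite /E -addn1 iotaD allpairs_cat add0n /=.
      by rewrite cats0.
    exists (y + a ^+ j * y').
      have [_ SD _] := mspan_submod K (E j.+1); apply: SD.
        by apply: mspan_sub Ey => t tE; apply: mspan_mem; rewrite EjS mem_cat tE.
      pose L := [set y | mspan K (E j.+1) (a ^+ j * y)].
      apply: (ey' L) => [|t te]; last first.
        by apply: mspan_mem; rewrite EjS mem_cat map_f ?orbT.
      have [S0 SD SM] := mspan_submod K (E j.+1).
      split=> [|u u'|c u cK]; rewrite /L /= ?mulr0 ?mulrDr //; first exact: SD.
      by rewrite mulrCA; apply: SM.
    exists (v + a ^+ j * v'), w'; split=> //.
      by apply: MD => //; apply: MM => //; rewrite rpredX.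
    rewrite opprD addrA xy exprSr -mulrA -[RHS]addrA -mulrDr -wy'.
    by rewrite mulrBr addrA.
  have [y Ey [v [w [Mv wD xy]]]] := iter n; exists y => //; rewrite xy.
  by apply: MD => //; rewrite mulrC; apply: MM => //; exact: QM.
have [e eD eP] : good [::].
  elim: gam mgam good_gam => // a s IH ms /good_step good_s; apply: IH.
    by move=> t ts; apply: ms; rewrite inE ts orbT.
  by apply: good_s; apply: ms; rewrite mem_head.
exists (size e), (fun i => e`_i); split=> [i|x xD]; first exact/eD/mem_nth.
have [||//|y ey Qxy] := eP (idpow D z 1) _ _ _ x xD.
- exact: idpow_submod.
- by [].
have [c Kc yc] := mspan_coord ey.
have [c' cc'] := choice (fun i => scalarsP _ _ (Kc i)).
exists c'; rewrite yc in Qxy.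
by under eq_bigr do rewrite -cc'.
Qed.

Let A := adjoins K [seq z i | i <- enum 'I_d].

Lemma paramsA i : z i \in A.
Proof. by apply: mem_adjoins; rewrite map_f // mem_enum. Qed.

Lemma paramsAD x : x \in A -> x \in D.
Proof.
apply: adjoins_min x => [x /scalarsP[c ->] //|x /mapP[i _ ->] //].
Qed.

(** After completion, D would be finite over the power series in [z]; this is what
remains of it without completing. *)
Lemma approx_params : exists N (e : 'I_N -> F), (forall i, e i \in D) /\
  forall J x, x \in D -> exists2 c : 'I_N -> F, (forall i, c i \in A) &
    idpow D z J (x - \sum_i c i * e i).
Proof.
have [N [e [eD eP]]] := finite_mod_params; exists N, e; split=> // J.
elim: J => [|J IH] x xD.
  exists (fun=> 0) => [i|]; first exact: rpred0.
  by rewrite big1 ?subr0 // => i _; rewrite mul0r.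
have [c /idpowSP[y [yD xy]]] := eP x xD.
have [a aA aP] := choice2 (fun l => IH (y l) (yD l)).
exists (fun i => emb (c i) + \sum_l z l * a l i) => [i|].
  rewrite rpredD //; first exact/sub_adjoins/mem_scalars.
  by apply: rpred_sum => l _; rewrite rpredM ?paramsA //; exact: aA.
exists (fun l => y l - \sum_i a l i * e i); split=> [l|]; first exact: aP.
under eq_bigr do rewrite mulrDl mulr_suml.
rewrite big_split opprD addrA xy exchange_big /= -sumrB.
apply: eq_bigr => l _; rewrite mulrBr mulr_sumr; congr (_ - _).
by apply: eq_bigr => i _; rewrite mulrA.
Qed.

(** Modulo the J-th power, multiplication by [b] on the span of the [e i] is given by
a matrix over k[z]; it is then annihilated by the characteristic polynomial, whose
degree does not depend on J. *)
Lemma cayley_hamilton_params b : b \in D -> exists N, forall J,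
  exists p : {poly F}, [/\ p \is a polyOver A, p \is monic, size p = N.+1
    & idpow D z J p.[b]].
Proof.
move=> bD; have [N [e [eD eP]]] := approx_params; exists N => J.
have [a aA aP] := choice2 (fun i => eP J _ (rpredM bD (eD i))).
pose M : 'M[F]_N := \matrix_(i, j) a i j.
have MA i j : M i j \in A by rewrite mxE; exact: aA.
exists (char_poly M).
split; [exact: char_poly_over | exact: char_poly_monic | exact: size_char_poly |].
rewrite horner_char_poly; set B := b%:M - M.
have BD i j : B i j \in D.
  by rewrite !mxE rpredB ?rpredMn // paramsAD //; exact: aA.
have adjD i j : (\adj B) i j \in D.
  rewrite mxE /cofactor rpredM ?rpredX ?rpredN ?rpred1 //.
  by apply: det_mem => i' j'; rewrite [row' _ _ _ _]mxE [col' _ _ _ _]mxE; exact: BD.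
pose v : 'cV[F]_N := \col_i e i.
have Bv i : idpow D z J ((B *m v) i 0).
  rewrite mxE; have := aP i; congr (idpow D z J _); apply/esym.
  under eq_bigr do rewrite !mxE mulrDl mulNr.
  rewrite sumrB; congr (_ - _).
  by rewrite (bigD1 i) //= eqxx big1 ?addr0 // => j; rewrite eq_sym => /negbTE ->; rewrite mul0r.
have detv i : idpow D z J (\det B * e i).
  have -> : \det B * e i = (\adj B *m (B *m v)) i 0.
    by rewrite mulmxA mul_adj_mx mul_scalar_mx !mxE.
  by rewrite mxE; apply: idpow_sum => j _; apply: idpowMl.
have [c cA c1] := eP J 1 (rpred1 _).
rewrite -[\det B]mulr1 -[1](subrK (\sum_i c i * e i)) mulrDr mulr_sumr.
apply: idpowD; first by apply: idpowMl => //; exact: det_mem.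
by apply: idpow_sum => i _; rewrite mulrCA; apply: idpowMl => //; exact: paramsAD.
Qed.

Lemma idpow1_m x : idpow D z 1 x -> m x.
Proof. by apply: idpow1_min => //; case: zP. Qed.

(** Were b D + Q^J to meet k[z] only in Q^J, for all J, then all the coefficients of
the characteristic polynomial would be in high powers of Q, one after the
other: the constant term p_0 because p_0 is congruent to a multiple of [b], and
the next ones because [artin_rees] allows dividing p(b) - p_0 by [b].  But the
leading coefficient is 1. *)
Lemma low_relation b : b \in D -> b != 0 -> exists J c y,
  [/\ c \in A, y \in D, idpow D z J (c - b * y) & ~ idpow D z J c].
Proof.
move=> bD b0; apply: contrapT => nrel.
have Acoef J c y : c \in A -> y \in D -> idpow D z J (c - b * y) -> idpow D z J c.
  by move=> cA yD cy; apply: contrapT => nc; apply: nrel; exists J, c, y.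
have coefs n J' : exists J, forall p : {poly F}, p \is a polyOver A ->
    (size p <= n)%N -> idpow D z J p.[b] -> forall i, idpow D z J' p`_i.
  elim: n J' => [|n IH] J'.
    exists 0%N => p _; rewrite leqn0 size_poly_eq0 => /eqP -> _ i.
    by rewrite coef0; exact: idpow0.
  have [J1 J1P] := IH J'; have [J2 J2P] := artin_rees zD b0 J1.
  exists (J2 + J')%N => p pA sp pJ.
  pose q := \poly_(i < n) p`_i.+1.
  have qA : q \is a polyOver A.
    by apply/polyOverP => i; rewrite coef_poly; case: ifP => _; rewrite ?rpred0 ?(polyOverP pA).
  have qD : q.[b] \in D.
    rewrite horner_coef; apply: rpred_sum => i _.
    by rewrite rpredM ?rpredX // paramsAD // (polyOverP qA).
  have pq : p = q * 'X + (p`_0)%:P.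
    apply/polyP => -[|i]; rewrite coefD coefMX coefC /= ?add0r // addr0 coef_poly.
    by case: ltnP => // ni; rewrite nth_default // (leq_trans sp).
  have pb : p.[b] = p`_0 - b * - q.[b].
    by rewrite {1}pq hornerMXaddC mulrN opprK addrC mulrC.
  have p0 : idpow D z (J2 + J') p`_0.
    apply: (@Acoef _ _ (- q.[b])); rewrite ?rpredN -?pb //.
    exact: (polyOverP pA).
  case=> [|i]; first exact: (idpow_le zD (leq_addl J2 J') p0).
  have -> : p`_i.+1 = q`_i.
    by rewrite {1}pq coefD coefMX coefC /= addr0.
  apply: (J1P q) => //; first exact: size_poly.
  apply: J2P => //; apply: (idpow_le zD (leq_addr J' J2)).
  have -> : b * q.[b] = p.[b] - p`_0 by rewrite pb; ring.
  by apply: idpowD => //; exact: idpowN.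
have [N NP] := cayley_hamilton_params bD.
have [J JP] := coefs N.+1 1%N; have [p [pA pmon sp pJ]] := NP J.
apply: m1; apply: idpow1_m; have /monicP := pmon; rewrite /lead_coef sp /= => <-.
by apply: (JP p) => //; rewrite sp.
Qed.

End Params.
Lemma mmap1_idpow d (z : 'I_d -> F) mon : idpow D z (mdeg mon) (mmap1 z mon).
Proof.
have zX i n : idpow D z n (z i ^+ n).
  elim: n => [|n IH]; first exact: rpred1.
  by rewrite exprS; apply: idpow_gen.
rewrite mdegE /mmap1; elim/big_rec2: _ => [|i x y _ Qxy]; first exact: rpred1.
exact: idpowM.
Qed.

(** The parameters left after the linear change of coordinates that moves the point
[v], normalized by v_0 = 1, to (1, 0, ..., 0), apart from z_0 itself. *)
Definition cut d (z : 'I_d.+1 -> F) (v : 'I_d.+1 -> k) (i : 'I_d) : F :=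
  z (lift ord0 i) - emb (v (lift ord0 i)) * z ord0.

Section Cut.
Variables (d : nat) (z : 'I_d.+1 -> F).
Hypothesis zP : params z.

Let zD i : z i \in D. Proof. by apply/mD; case: zP. Qed.

Lemma cut_m v i : m (cut z v i).
Proof.
have [_ mDD mM] := msub; apply: mDD; first by case: zP.
by rewrite -mulNr; apply: mM; [rewrite rpredN | case: zP].
Qed.

Lemma cutD v i : cut z v i \in D.
Proof. exact/mD/cut_m. Qed.

Lemma cut_congr v i : v ord0 = 1 -> idpow D (cut z v) 1 (z i - z ord0 * emb (v i)).
Proof.
move=> v0; case: (unliftP ord0 i) => [j|] ->.
  by rewrite mulrC; exact: mem_idpow1.
by rewrite v0 rmorph1 mulr1 subrr; exact: idpow0.
Qed.

Lemma idpow_cut v l x : v ord0 = 1 -> idpow D z l x ->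
  exists2 u, u \in D & idpow D (cut z v) 1 (x - z ord0 ^+ l * u).
Proof.
move=> v0; elim: l x => [|l IH] x.
  by exists x => //; rewrite expr0 mul1r subrr; exact: idpow0.
move=> /idpowSP[y [yl ->]]; have [u uD yu] := choice2 (fun i => IH (y i) (yl i)).
exists (\sum_i emb (v i) * u i).
  by apply: rpred_sum => i _; rewrite rpredM.
rewrite mulr_sumr -sumrB; apply: idpow_sum => i _.
have -> : z i * y i - z ord0 ^+ l.+1 * (emb (v i) * u i) =
   z i * (y i - z ord0 ^+ l * u i) +
   z ord0 ^+ l * u i * (z i - z ord0 * emb (v i)) by rewrite exprS; ring.
apply: idpowD; apply: idpowMl => //; last exact: cut_congr.
by rewrite rpredM // rpredX.
Qed.

(** The relation of [low_relation] involves a nonzero lowest form [f] in degree [j].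
At a point [v] where f does not vanish, f(z) is congruent to f(v) z_0^j modulo the
elements of [cut z v], while the terms of higher degree only change the
coefficient f(v) by an element of [m], so that it remains a unit. *)
Lemma cut_relation b : b \in D -> b != 0 -> exists v j y,
  [/\ v ord0 = 1, y \in D & idpow D (cut z v) 1 (z ord0 ^+ j - b * y)].
Proof.
move=> bD b0; have [J [c [y [cA yD cy nc]]]] := low_relation zP bD b0.
have [p cp] := adjoins_mmap cA.
have cE : c = \sum_(mon <- msupp p) emb p@_mon * mmap1 z mon by rewrite cp.
have high l (P : pred _) : (forall mon, mon \in msupp p -> P mon -> l <= mdeg mon)%N ->
    idpow D z l (\sum_(mon <- msupp p | P mon) emb p@_mon * mmap1 z mon).
  move=> lP; rewrite big_seq_cond; apply: idpow_sum => // mon /andP[mp Pm].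
  by apply: idpowMl => //; apply: (idpow_le zD (lP _ mp Pm)); exact: mmap1_idpow.
have ex : exists j, has (fun mon => mdeg mon == j) (msupp p).
  have : p != 0 by apply/eqP => p0; apply: nc; rewrite cp p0 raddf0; exact: idpow0.
  by move=> /mlead_supp pl; exists (mdeg (mlead p)); apply/hasP; exists (mlead p).
have [j /hasP[m0 m0p /eqP m0j] minj] := ex_minnP ex.
have {}minj mon : mon \in msupp p -> (j <= mdeg mon)%N.
  by move=> mp; apply: minj; apply/hasP; exists mon.
have jJ : (j < J)%N.
  rewrite ltnNge; apply/negP => Jj; apply: nc; rewrite cE; apply: high => mon mp _.
  exact: leq_trans (minj _ mp).
pose f := \sum_(mon <- msupp p | mdeg mon == j) p@_mon *: 'X_[mon].
have fE (C : comNzRingType) (h : {rmorphism k -> C}) (u : 'I_d.+1 -> C) :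
    mmap h u f = \sum_(mon <- msupp p | mdeg mon == j) h p@_mon * mmap1 u mon.
  by rewrite rmorph_sum /=; apply: eq_bigr => mon _; rewrite mmapZ mmapX.
have f0 : f != 0.
  apply/eqP => /(congr1 (mcoeff m0)); rewrite mcoeff0 raddf_sum /=.
  rewrite -big_filter (bigD1_seq m0) /=; last by rewrite filter_uniq ?msupp_uniq.
    rewrite mcoeffZ mcoeffX eqxx mulr1 big1 ?addr0.
      by move/eqP; rewrite mcoeff_eq0 m0p.
    by move=> mon mm; rewrite mcoeffZ mcoeffX (negbTE mm) mulr0.
  by rewrite mem_filter m0j eqxx.
have fscale (C : comNzRingType) (h : {rmorphism k -> C}) t (u : 'I_d.+1 -> C) :
    mmap h (fun i => t * u i) f = t ^+ j * mmap h u f.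
  rewrite !fE mulr_sumr; apply: eq_bigr => mon /eqP <-.
  by rewrite mmap1_scale mulrCA.
have [al fal al0] := mpoly_nonroot f0.
pose v i := al i / al ord0.
have v0 : v ord0 = 1 by rewrite /v divff.
have fv : f.@[v] != 0.
  apply: contra_neq fal => fv0; rewrite -[RHS](mulr0 (al ord0 ^+ j)) -fv0.
  rewrite -!mmap_id -fscale; congr (mmap _ _ f).
  by apply/funext => i; rewrite /v mulrC divfK.
have fz : idpow D z j.+1 (mmap emb z f - b * y).
  have -> : mmap emb z f - b * y = (c - b * y) -
      \sum_(mon <- msupp p | mdeg mon != j) emb p@_mon * mmap1 z mon.
    have -> : c = mmap emb z f +
        \sum_(mon <- msupp p | mdeg mon != j) emb p@_mon * mmap1 z mon.
      by rewrite fE cE (bigID (fun mon => mdeg mon == j)).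
    by ring.
  apply: idpowD; first exact: (idpow_le zD jJ).
  apply: idpowN; apply: high => mon mp mj.
  by rewrite ltn_neqAle eq_sym mj minj.
have [u uD fu] := idpow_cut v0 fz.
pose w := emb f.@[v] - z ord0 * u.
have wD : w \in D by rewrite rpredB ?rpredM.
have mw : ~ m w.
  move=> mw; have [_ mDD mM] := msub.
  apply: m1; rewrite -(mulVf (_ : emb f.@[v] != 0)) ?fmorph_eq0 //.
  rewrite -fmorphV; apply: (mM) => //; rewrite -(subrK (z ord0 * u) (emb _)).
  by apply: mDD => //; rewrite mulrC; apply: mM => //; case: zP.
exists v, j, (w^-1 * y); split=> //; first by rewrite rpredM ?Dloc.
have w0 : w != 0 by apply/eqP => w0; apply: mw; rewrite w0; case: msub.
have -> : z ord0 ^+ j - b * (w^-1 * y) = w^-1 * (z ord0 ^+ j * w - b * y).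
  by rewrite mulrBr [_ * w]mulrC mulKf // mulrCA.
apply: idpowMl; rewrite ?Dloc //.
have -> : z ord0 ^+ j * w - b * y =
    (mmap emb z f - b * y - z ord0 ^+ j.+1 * u) -
    (mmap emb z f - z ord0 ^+ j * emb f.@[v]) by rewrite /w exprS; ring.
apply: idpowD => //; apply: idpowN.
rewrite -mmap_id mmap_comp -fscale.
apply: (mmap_congr embD) => [||i|i]; [exact: idpow_submod | by [] | |].
  by apply: rpredM => //; exact: embD.
exact: cut_congr.
Qed.

End Cut.

Lemma submod_subX M x y n : submod D M -> x \in D -> y \in D -> M (x - y) ->
  M (x ^+ n - y ^+ n).
Proof.
move=> [_ _ MM] xD yD xy; rewrite subrXX mulrC; apply: MM => //.
by apply: rpred_sum => i _; rewrite rpredM ?rpredX.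
Qed.

(** The existence of [b] says that the fraction field is obtained from D by
inverting one element. *)
Variable b : F.
Hypothesis bD : b \in D.
Hypothesis b0 : b != 0.
Hypothesis bpow : forall x, x \in D -> x != 0 ->
  exists N y, y \in D /\ b ^+ N = x * y.

(** With z a smallest family of parameters: if there are at least two of them,
z_0^j = b y modulo [cut z v], and some element of [cut z v] divides a power of [b],
so that [cut z v] alone would be a family of parameters.  If all elements of
[cut z v] vanish, z_0 alone would be one. *)
Theorem dimension_le1 : (forall x, m x -> x = 0) \/ exists z, [/\ m z, z != 0,
    forall x, x \in D -> x != 0 -> exists j y, y \in D /\ z ^+ j = x * y
  & exists N (e : 'I_N -> F), forall x, x \in D ->
    exists (c : 'I_N -> k) y, y \in D /\ x - \sum_i emb (c i) * e i = z * y].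
Proof.
have [|mn0] := pselect (forall x, m x -> x = 0); [by left | right].
have ex : exists d, `[< exists z : 'I_d -> F, params z >].
  exists (size gam); apply/asboolP; exists (fun i => gam`_i); split=> [i|x mx].
    exact/mgam/mem_nth.
  exists 1%N; rewrite expr1; apply: (mgen mx); first exact: idpow_submod.
  move=> a /(nthP 0)[i ig <-].
  exact: (@mem_idpow1 F D (size gam) (fun i => gam`_i) (Ordinal ig)).
have [[|d] /asboolP[z zP] mind] := ex_minnP ex.
  case: mn0 => x /(zP.2)[M /idpowSP[y [_]]]; rewrite big_ord0 => /eqP.
  by rewrite expf_eq0 => /andP[_ /eqP].
have {}mind d' (z' : 'I_d' -> F) : params z' -> (d < d')%N.
  by move=> z'P; apply: mind; apply/asboolP; exists z'.
have zD i : z i \in D by apply/mD; case: zP.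
case: d => [|d] in z zP mind zD *.
  exists (z ord0); split; first by case: zP.
    apply/eqP => z0; apply: mn0 => x /(zP.2)[M /idpowSP[y [_]]] /eqP.
    by rewrite big_ord1 z0 mul0r expf_eq0 => /andP[_ /eqP].
    move=> x xD x0; have [v [j [y [v0 yD]]]] := cut_relation zP xD x0.
    move=> /idpowSP[y' [_]]; rewrite big_ord0 => /eqP; rewrite subr_eq0 => /eqP.
    by exists j, y.
  have [N [e [eD eP]]] := finite_mod_params zP; exists N, e => x xD.
  have [c /idpowSP[y [yD]]] := eP x xD; rewrite big_ord1 => xy.
  by exists c, (y ord0); split=> //; exact: (yD ord0).
have [v [j [y [v0 yD zj]]]] := cut_relation zP bD b0.
have cD i : cut z v i \in D by exact: cutD.
have subQ := idpow_submod D (cut z v) 1.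
have [[i zi]|z0] := pselect (exists i, cut z v i != 0); last first.
  have {}z0 i : z i = z ord0 * emb (v i).
    apply/eqP; rewrite -subr_eq0; apply/eqP.
    have /idpowSP[y' [_ ->]] := cut_congr z i v0.
    rewrite big1 // => l _; apply/eqP; rewrite mulf_eq0; apply/orP; left.
    by apply: contrapT => /negP zl; apply: z0; exists l.
  suff /mind : params (fun _ : 'I_1 => z ord0) by [].
  split=> [_|x /(zP.2)[M /idpowSP[y' [y'D xy]]]]; first by case: zP.
  exists M; rewrite xy; apply: idpow_sum => // l _.
  rewrite [z l]z0 -mulrA; apply: (idpow_gen (z := fun _ : 'I_1 => z ord0) ord0).
  by apply: rpredM => //; exact: y'D.
have [N [w [wD bN]]] := bpow (cD i) zi.
have bQ : idpow D (cut z v) 1 (b ^+ N) by rewrite bN; apply: idpow_gen.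
have zQ : idpow D (cut z v) 1 (z ord0 ^+ (j * N)).
  rewrite exprM -[_ ^+ N](subrK ((b * y) ^+ N)); apply: idpowD.
    by apply: submod_subX; rewrite ?rpredX ?rpredM.
  by rewrite exprMn mulrC; apply: idpowMl; rewrite ?rpredX.
suff /mind : params (cut z v) by rewrite ltnn.
split=> [l|x mx]; first exact: cut_m.
have [M xM] := zP.2 _ mx; have [u uD xu] := idpow_cut zP v0 xM.
exists (M * (j * N))%N.
rewrite exprM -[_ ^+ (j * N)](subrK ((z ord0 ^+ 1 * u) ^+ (j * N))); apply: idpowD.
  by apply: submod_subX => //; [exact/rpredX/mD | rewrite rpredM ?rpredX].
by rewrite expr1 exprMn mulrC; apply: idpowMl; rewrite ?rpredX.
Qed.

End LocalRing.

(** * Extension of homomorphisms to places *)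

Section Places.
Variables (k : closedFieldType) (F : fieldType) (emb : {rmorphism k -> F}).
Implicit Types (G : set (F * k)) (P R : {poly F}) (p q : {poly k}).

(** The graph of a homomorphism to k defined on a subalgebra of F.  Ordering graphs by
inclusion, maximal homomorphisms are found without any dependent types. *)
Definition partial_hom G : Prop :=
  [/\ forall c, G (emb c, c),
      forall x y a b, G (x, a) -> G (y, b) -> G (x - y, a - b),
      forall x y a b, G (x, a) -> G (y, b) -> G (x * y, a * b)
    & forall c, G (0, c) -> c = 0].

Section Closure.
Variable G : set (F * k).
Hypothesis homG : partial_hom G.

Lemma phomC c : G (emb c, c).
Proof. by case: homG. Qed.
Lemma phom0 : G (0, 0).
Proof. by case: homG => /(_ 0); rewrite rmorph0. Qed.
Lemma phom1 : G (1, 1).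
Proof. by case: homG => /(_ 1); rewrite rmorph1. Qed.
Lemma phom_eq0 c : G (0, c) -> c = 0.
Proof. by case: homG => _ _ _; apply. Qed.
Lemma phomB x y a b : G (x, a) -> G (y, b) -> G (x - y, a - b).
Proof. by case: homG => _ + _ _; apply. Qed.
Lemma phomN x a : G (x, a) -> G (- x, - a).
Proof. by move=> xa; rewrite -[- x]add0r -[- a]add0r; apply: phomB phom0 xa. Qed.
Lemma phomD x y a b : G (x, a) -> G (y, b) -> G (x + y, a + b).
Proof. by move=> xa /phomN yb; rewrite -[y]opprK -[b]opprK; apply: phomB. Qed.
Lemma phomM x y a b : G (x, a) -> G (y, b) -> G (x * y, a * b).
Proof. by case: homG => _ _ + _; apply. Qed.
Lemma phomX x a n : G (x, a) -> G (x ^+ n, a ^+ n).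
Proof.
move=> xa; elim: n => [|n IH]; first exact: phom1.
by rewrite !exprS; apply: phomM.
Qed.
Lemma phom_sum n (x : 'I_n -> F) (a : 'I_n -> k) :
  (forall i, G (x i, a i)) -> G (\sum_i x i, \sum_i a i).
Proof.
move=> xa; elim/big_rec2: _ => [|i c b _ bc]; first exact: phom0.
exact: phomD.
Qed.
Lemma phom_fun x a b : G (x, a) -> G (x, b) -> a = b.
Proof.
move=> xa xb; apply/eqP; rewrite -subr_eq0; apply/eqP.
by case: homG => _ _ _; apply; rewrite -[X in G (X, _)](subrr x); apply: phomB.
Qed.

Definition poly_hom P p := forall i, G (P`_i, p`_i).

Lemma poly_homM P p R q : poly_hom P p -> poly_hom R q -> poly_hom (P * R) (p * q).
Proof.
move=> Pp Rq i; rewrite !coefM; apply: phom_sum => j.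
by apply: phomM; [exact: Pp | exact: Rq].
Qed.

Lemma poly_homB P p R q : poly_hom P p -> poly_hom R q -> poly_hom (P - R) (p - q).
Proof. by move=> Pp Rq i; rewrite !coefB; apply: phomB; [exact: Pp | exact: Rq]. Qed.

Lemma poly_hom_map p : poly_hom (map_poly emb p) p.
Proof. by move=> i; rewrite coef_map; exact: phomC. Qed.

Definition hom_adjoin (f : F) (l : k) : set (F * k) :=
  [set xa | exists P p, poly_hom P p /\ xa = (P.[f], p.[l])].

Lemma hom_adjoin_partial f l :
    (forall P p, poly_hom P p -> P.[f] = 0 -> p.[l] = 0) ->
  [/\ partial_hom (hom_adjoin f l), G `<=` hom_adjoin f l & hom_adjoin f l (f, l)].
Proof.
move=> fl; split; first split.
- move=> c; exists (emb c)%:P, c%:P; rewrite !hornerC; split=> // i.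
  by rewrite !coefC; case: eqP => _; [exact: phomC | exact: phom0].
- move=> _ _ _ _ [P [p [Pp [-> ->]]]] [R [q [Rq [-> ->]]]].
  by exists (P - R), (p - q); rewrite !hornerD !hornerN; split=> //; apply: poly_homB.
- move=> _ _ _ _ [P [p [Pp [-> ->]]]] [R [q [Rq [-> ->]]]].
  by exists (P * R), (p * q); rewrite !hornerM; split=> //; apply: poly_homM.
- by move=> c [P [p [Pp [/esym P0 ->]]]]; apply: fl P0.
- case=> x a xa; exists x%:P, a%:P; rewrite !hornerC; split=> // i.
  by rewrite !coefC; case: eqP => _; [| exact: phom0].
- exists 'X, 'X; rewrite !hornerX; split=> // i.
  by rewrite !coefX; case: eqP => _; [exact: phom1 | exact: phom0].
Qed.

Hypothesis maxG : forall G', G `<=` G' -> partial_hom G' -> G' `<=` G.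

Lemma max_hom_mem f l :
  (forall P p, poly_hom P p -> P.[f] = 0 -> p.[l] = 0) -> G (f, l).
Proof.
by move=> /hom_adjoin_partial[homG' GG' fl]; apply: (maxG GG').
Qed.

(** A relation satisfied by 1/f becomes, after multiplication by a power of [f], a
relation between elements of the domain. *)
Lemma max_homV f c : G (f, c) -> c != 0 -> G (f^-1, c^-1).
Proof.
move=> fc c0; have f0 : f != 0.
  apply: contra_neq c0 => f0; rewrite f0 in fc.
  by case: homG => _ _ _; apply.
apply: max_hom_mem => P p Pp Pf.
pose n := maxn (size P) (size p).
have rev (K : fieldType) (u : K) (q : {poly K}) : u != 0 -> (size q <= n)%N ->
    u ^+ n * q.[u^-1] = \sum_(i < n) q`_i * u ^+ (n - i).
  move=> u0 qn; rewrite (horner_coef_wide _ qn) mulr_sumr; apply: eq_bigr => i _.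
  by rewrite mulrCA exprVn expfB.
have : G (f ^+ n * P.[f^-1], c ^+ n * p.[c^-1]).
  rewrite !rev ?leq_maxl ?leq_maxr //.
  by apply: phom_sum => i; apply: phomM => //; apply: phomX.
rewrite Pf mulr0; move=> /phom_eq0/eqP.
by rewrite mulf_eq0 expf_eq0 (negbTE c0) andbF => /eqP.
Qed.

(** The obstruction to giving [f] a finite value, as 1 would have residue zero. *)
Definition infinity_relation f n :=
  exists P, [/\ forall i, G (P`_i, 0), (size P <= n.+1)%N & P.[f] = 1].

(** The residues of the relations satisfied by [f] form an ideal of k[X].  A common root
is a possible value of [f]; there is one, k being algebraically closed, unless the
ideal contains a nonzero constant. *)
Lemma max_hom_or_infinity f : (exists c, G (f, c)) \/ exists n, infinity_relation f n.
Proof.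
pose I q := exists P, poly_hom P q /\ P.[f] = 0.
have IB q q' : I q -> I q' -> I (q - q').
  move=> [P [Pq Pf]] [P' [Pq' Pf']]; exists (P - P'); rewrite hornerD hornerN Pf Pf'.
  by rewrite subrr; split=> //; apply: poly_homB.
have IM r q : I q -> I (r * q).
  move=> [P [Pq Pf]]; exists (map_poly emb r * P); rewrite hornerM Pf mulr0.
  by split=> //; apply: poly_homM => //; apply: poly_hom_map.
have [[c c0 [P [Pc Pf]]]|I1] := pselect (exists2 c, c != 0 & I c%:P).
  right; exists (size (1 - (emb c^-1)%:P * P)), (1 - (emb c^-1)%:P * P).
  rewrite leqnSn hornerD hornerN hornerM Pf mulr0 subr0 hornerC; split=> // i.
  have -> : 0 = (1 - (c^-1)%:P * c%:P)`_i :> k.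
    by rewrite -polyCM mulVf // subrr coef0.
  apply: poly_homB; last (apply: poly_homM => //).
    by rewrite -(rmorph1 (map_poly emb)); apply: poly_hom_map.
  by rewrite -(map_polyC emb); apply: poly_hom_map.
left; suff [l lP] : exists l, forall q, I q -> q.[l] = 0.
  by exists l; apply: max_hom_mem => P p Pp Pf; apply: lP; exists P.
have [I0|] := pselect (forall q, I q -> q = 0).
  by exists 0 => q /I0 ->; rewrite horner0.
move=> /existsNP[q1 /not_implyP[Iq1 /eqP q1n0]].
have ex : exists n, `[< exists q, [/\ I q, q != 0 & size q = n] >].
  by exists (size q1); apply/asboolP; exists q1.
have [n /asboolP[q0 [Iq0 q0n0 sq0]] minn] := ex_minnP ex.
have /closed_rootP[l /rootP ql] : size q0 != 1%N.
  apply/negP => /size_poly1P[c c0 qc]; apply: I1.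
  by exists c => //; rewrite -qc.
exists l => q Iq; have r0 : q %% q0 = 0.
  apply/eqP; apply: contrapT => /negP r0.
  have /minn : `[< exists r, [/\ I r, r != 0 & size r = size (q %% q0)] >].
    apply/asboolP; exists (q %% q0); split=> //.
    have -> : q %% q0 = q - q %/ q0 * q0 by rewrite [in X in X - _](divp_eq q q0) addrC addKr.
    by apply: IB => //; apply: IM.
  by rewrite leqNgt -sq0 ltn_modp q0n0.
by rewrite (divp_eq q q0) r0 addr0 hornerM ql mulr0.
Qed.

(** Chevalley's descent: of the two relations, the one of larger degree can be
shortened by means of the other, whose coefficient 1 - R_0 is a unit. *)
Lemma infinity_relation_contra f n n' :
  f != 0 -> infinity_relation f n -> infinity_relation f^-1 n' -> False.
Proof.
have [N Nn] : exists N, (n + n' < N)%N by exists (n + n').+1.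
elim: N f n n' Nn => // N IH f n n' Nn f0 fn fn'.
wlog n'n : f n n' Nn f0 fn fn' / (n' <= n)%N.
  move=> wl; have [n'n|/ltnW nn'] := leqP n' n; first exact: (wl f n n').
  by apply: (wl f^-1 n' n); rewrite ?invrK ?invr_eq0 // addnC.
case: fn => P [GP sP Pf]; case: fn' => R [GR sR Rf].
have G1 : G (1, 0) -> False.
  by move=> /phom_fun/(_ phom1)/esym/eqP; rewrite oner_eq0.
case: n => [|n] in Nn n'n sP *.
  by apply: G1; rewrite -Pf (size1_polyC sP) hornerC.
pose u := 1 - R`_0.
have Gu : G (u, 1) by rewrite -[1 in X in G X]subr0; exact: phomB phom1 (GR _).
have u0 : u != 0.
  apply: contra_notN G1 => /eqP u0; move: Gu; rewrite u0.
  by move/phom_eq0/eqP; rewrite oner_eq0.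
have Gv : G (u^-1, 1) by rewrite -[1]invr1; apply: max_homV; rewrite ?oner_neq0.
apply: (IH f n n') => //; last by exists R.
exists (\poly_(i < n.+1) (P`_i + P`_n.+1 * u^-1 * R`_(n.+1 - i))).
split.
- move=> i; rewrite coef_poly; case: ifP => _; last exact: phom0.
  have := phomD (GP i) (phomM (phomM (GP n.+1) Gv) (GR (n.+1 - i)%N)).
  by rewrite mul0r mulr0 addr0.
- exact: size_poly.
have fu : \sum_(i < n.+1) R`_(n.+1 - i) * f ^+ i = f ^+ n.+1 * u.
  have -> : u = \sum_(i < n.+1) R`_i.+1 * f^-1 ^+ i.+1.
    rewrite /u -Rf (@horner_coef_wide _ n.+2); last by rewrite (leq_trans sR).
    by rewrite big_ord_recl expr0 mulr1 addrC addKr.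
  rewrite mulr_sumr (reindex_inj rev_ord_inj) /=; apply: eq_bigr => i _.
  by rewrite subKn ?ltn_ord // [RHS]mulrCA exprVn expfB_cond ?(negbTE f0) // ltn_ord.
rewrite horner_poly -Pf (horner_coef_wide _ sP) [RHS]big_ord_recr /=.
transitivity (\sum_(i < n.+1) (P`_i * f ^+ i + P`_n.+1 * u^-1 * (R`_(n.+1 - i) * f ^+ i))).
  by apply: eq_bigr => i _; rewrite mulrDl !mulrA.
rewrite big_split -mulr_sumr fu /=; congr (_ + _).
by rewrite -mulrA [u^-1 * _]mulrC mulfK.
Qed.

End Closure.

(** Chevalley's extension theorem, with residue field [k]. *)
Theorem place_ex G0 : partial_hom G0 ->
  exists G, [/\ G0 `<=` G, partial_hom G &
    forall f, (exists c, G (f, c)) \/ G (f^-1, 0)].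
Proof.
move=> hom0; have [|G [G0G homG maxG]] := @Zorn_above _ partial_hom G0 hom0.
  move=> C [A CA] Chom totC; have both x y : (\bigcup_(A in C) A) x ->
      (\bigcup_(A in C) A) y -> exists A, [/\ C A, A x & A y].
    move=> [B CB Bx] [D CD Dy]; have [BD|DB] := totC _ _ CB CD.
      by exists D; split=> //; exact: BD.
    by exists B; split=> //; exact: DB.
  split.
  - by move=> c; exists A => //; case: (Chom _ CA).
  - move=> x y a b Cx Cy; have [B [CB Bx By]] := both _ _ Cx Cy.
    by exists B => //; apply: (phomB (Chom _ CB)).
  - move=> x y a b Cx Cy; have [B [CB Bx By]] := both _ _ Cx Cy.
    by exists B => //; apply: (phomM (Chom _ CB)).
  - by move=> c [B CB B0]; case: (Chom _ CB) => _ _ _; apply.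
exists G; split=> // f; have [->|f0] := eqVneq f 0.
  by left; exists 0; exact: phom0.
have [|[n fn]] := max_hom_or_infinity homG maxG f; first by left.
have [[c fc]|[n' fn']] := max_hom_or_infinity homG maxG f^-1.
  have [c0|c0] := eqVneq c 0; first by right; rewrite -c0.
  by left; exists c^-1; rewrite -[f]invrK; apply: (max_homV homG maxG).
by case: (infinity_relation_contra homG maxG f0 fn fn').
Qed.

End Places.

(** * Discreteness of the valuation *)

Section Uniformizer.
Variables (k : closedFieldType) (F : fieldType) (emb : {rmorphism k -> F}).
Variables (G : set (F * k)) (D : subringClosed F).
Hypothesis homG : partial_hom emb G.
Hypothesis valG : forall f, (exists c, G (f, c)) \/ G (f^-1, 0).

Let O : set F := [set x | exists c, G (x, c)].
Let mO : set F := [set x | G (x, 0)].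

Let O1 : O 1. Proof. by exists 1; exact: phom1 homG. Qed.
Let OM x y : O x -> O y -> O (x * y).
Proof. by move=> [a xa] [b yb]; exists (a * b); exact: (phomM homG). Qed.
Let OX x n : O x -> O (x ^+ n).
Proof. by move=> [a xa]; exists (a ^+ n); exact: (phomX homG). Qed.
Let mOM x y : O x -> mO y -> mO (x * y).
Proof. by move=> [a xa] yb; rewrite /mO /= -(mulr0 a); exact: (phomM homG). Qed.
Let mO_O x : mO x -> O x. Proof. by exists 0. Qed.
Let mO1 : ~ mO 1.
Proof. by move=> /(phom_fun homG)/(_ (phom1 homG))/esym/eqP; rewrite oner_eq0. Qed.
Let mOX x n : mO x -> mO (x ^+ n.+1).
Proof. by move=> mx; rewrite exprSr; apply: mOM => //; apply/OX/mO_O. Qed.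
Let embO c : O (emb c). Proof. by exists c; exact: (phomC homG). Qed.

Hypothesis embD : forall c, emb c \in D.
Hypothesis DO : forall x, x \in D -> O x.
Hypothesis fracD : forall f, exists x y, [/\ x \in D, y \in D, y != 0 & f = x / y].
Variable z : F.
Hypothesis z0 : z != 0.
Hypothesis mz : mO z.
Hypothesis zD : z \in D.
Hypothesis zpow : forall x, x \in D -> x != 0 -> exists j y, y \in D /\ z ^+ j = x * y.
Variables (N : nat) (e : 'I_N -> F).
Hypothesis spanD : forall x, x \in D ->
  exists (c : 'I_N -> k) y, y \in D /\ x - \sum_i emb (c i) * e i = z * y.

Lemma truncated_expansion n x : x \in D -> exists (c : 'I_n -> 'I_N -> k) y,
  y \in D /\ x = \sum_l \sum_i emb (c l i) * (e i * z ^+ l) + z ^+ n * y.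
Proof.
elim: n x => [|n IH] x xD.
  by exists (fun _ _ => 0), x; rewrite big_ord0 add0r expr0 mul1r.
have [c [y [yD xy]]] := spanD xD; have [c' [y' [y'D yy']]] := IH y yD.
exists (fun l => if unlift ord0 l is Some l' then c' l' else c), y'; split=> //.
rewrite big_ord_recl unlift_none /= -[x](subrK (\sum_i emb (c i) * e i)) xy addrC.
rewrite -addrA; congr (_ + _).
  by apply: eq_bigr => i _; rewrite expr0 mulr1.
rewrite yy' mulrDr mulr_sumr exprS mulrA; congr (_ + _).
apply: eq_bigr => l _; rewrite liftK mulr_sumr; apply: eq_bigr => i _.
by rewrite exprS; ring.
Qed.

Lemma wide_kernel (K : fieldType) (p q : nat) (M : 'M[K]_(p, q)) : (q < p)%N ->
  exists2 u : 'rV[K]_p, u != 0 & u *m M = 0.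
Proof.
move=> qp; have : kermx M != 0.
  by rewrite kermx_eq0 /row_free neq_ltn (leq_ltn_trans (rank_leq_col M)).
by case/rowV0Pn => u /sub_kermxP uM u0; exists u.
Qed.

Lemma place_inv s c : G (s, c) -> c != 0 -> O s^-1.
Proof.
move=> sc c0; have [//|] := valG s^-1; rewrite invrK => /(phom_fun homG sc) cE.
by rewrite cE eqxx in c0.
Qed.

Lemma mO_sum (I : Type) (r : seq I) (P : pred I) (f : I -> F) :
  (forall i, P i -> mO (f i)) -> mO (\sum_(i <- r | P i) f i).
Proof.
move=> mf; elim/big_rec: _ => [|i x Pi mx]; first exact: (phom0 homG).
by rewrite /mO /= -(addr0 0); apply: (phomD homG) => //; exact: mf.
Qed.

(** Suppose that z does not divide f^N.  Writing f = x / x', the elements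
f^i x'^N z^j with i <= N and j < J are in D and have distinct values, namely
increasing with i + (N + 1) j, and all less than the value of z^(J + C) for a
constant C depending on x'.  Hence they are linearly independent modulo
z^(J + C), where D has dimension at most N (J + C).  This fails for J > N C. *)
Lemma pow_mem_param f : mO f -> exists2 y, O y & f ^+ N = z * y.
Proof.
move=> mf; apply: contrapT => nfN.
have N0 : (0 < N)%N.
  rewrite lt0n; apply/eqP => N0; have [c [y [yD]]] := spanD (rpred1 D).
  rewrite big1 ?subr0 => [z1|[i iN] _]; last by exfalso; move: iN; rewrite N0.
  by apply: mO1; rewrite z1 mulrC; apply: mOM => //; exact: DO.
have f0 : f != 0.
  apply/eqP => f0; apply: nfN; exists 0; first by exists 0; exact: (phom0 homG).
  by rewrite f0 expr0n mulr0 eqn0Ngt N0.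
have zfN : mO (z / f ^+ N).
  have [fz|] := valG (f ^+ N / z); last by rewrite invf_div.
  by case: nfN; exists (f ^+ N / z) => //; rewrite mulrC divfK.
have zf i : (i <= N)%N -> mO (z / f ^+ i).
  move=> iN; have -> : z / f ^+ i = f ^+ (N - i) * (z / f ^+ N).
    rewrite -{2}(subnK iN) exprD; field.
    by rewrite !expf_neq0.
  by apply: mOM => //; apply/OX/mO_O.
have [x [x' [xD x'D x'0 fxx]]] := fracD f.
have [C [y0 [y0D zC]]] := zpow (rpredX N x'D) (expf_neq0 N x'0).
pose J := (N * C).+1; pose n1 := (N.+1 * J)%N; pose n2 := (J + C)%N.
(* The pair (i, j) is encoded by a = i + (N + 1) j. *)
pose w a := f ^+ (a %% N.+1) * x' ^+ N * z ^+ (a %/ N.+1).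
have wD a : w a \in D.
  have aN : (a %% N.+1 <= N)%N by rewrite -ltnS ltn_pmod.
  rewrite /w rpredM ?rpredX //.
  have -> : f ^+ (a %% N.+1) * x' ^+ N = x ^+ (a %% N.+1) * x' ^+ (N - a %% N.+1).
    rewrite -{2}(subnK aN) exprD fxx expr_div_n; field.
    by rewrite expf_neq0.
  by rewrite rpredM ?rpredX.
have w0 a : w a != 0 by rewrite /w !mulf_neq0 ?expf_neq0.
have wlt a b : (a < b)%N -> mO (w b / w a).
  move=> ab; have := leq_div2r N.+1 (ltnW ab); rewrite leq_eqVlt => /predU1P[ej|jj'].
    have ii' : (a %% N.+1 < b %% N.+1)%N.
      by move: ab; rewrite {1}(divn_eq a N.+1) {1}(divn_eq b N.+1) ej ltn_add2l.
    have -> : w b / w a = f ^+ (b %% N.+1 - a %% N.+1).-1.+1.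
      rewrite /w ej prednK ?subn_gt0 // -{1}(subnK (ltnW ii')) exprD; field.
      by rewrite ?x'0 ?f0 ?expf_neq0.
    exact: mOX.
  have -> : w b / w a = f ^+ (b %% N.+1) * z ^+ (b %/ N.+1 - (a %/ N.+1).+1) *
      (z / f ^+ (a %% N.+1)).
    rewrite /w -{1}(subnK jj') exprD exprS; field.
    by rewrite ?x'0 ?f0 ?expf_neq0.
  apply: mOM; first by apply: OM; apply/OX/mO_O.
  by apply: zf; rewrite -ltnS ltn_pmod.
have /choice[c cP] (a : 'I_n1) := truncated_expansion n2 (wD a).
have /choice[y yP] (a : 'I_n1) := cP a.
have yD a : y a \in D by case: (yP a).
have wE (a : 'I_n1) :
    w a = \sum_l \sum_i emb (c a l i) * (e i * z ^+ l) + z ^+ n2 * y a.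
  by case: (yP a).
pose M : 'M[k]_(n1, n2 * N) :=
  \matrix_(a, b) mxvec (\matrix_(l < n2, i < N) c a l i) 0 b.
have [|u u0 uM] := @wide_kernel _ _ _ M.
  by rewrite /n1 /n2 /J; nia.
have uc l i : \sum_a u 0 a * c a l i = 0.
  transitivity ((u *m M) 0 (mxvec_index l i)); last by rewrite uM mxE.
  rewrite mxE; apply: eq_bigr => a _.
  by rewrite mxE mxvecE mxE.
have sumw : \sum_a emb (u 0 a) * w a = z ^+ n2 * \sum_a emb (u 0 a) * y a.
  have split3 : forall a : 'I_n1, true -> emb (u 0 a) * w a =
      \sum_l \sum_i emb (u 0 a * c a l i) * (e i * z ^+ l) +
      z ^+ n2 * (emb (u 0 a) * y a).
    move=> a _; rewrite wE mulrDr mulrCA; congr (_ + _).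
    rewrite mulr_sumr; apply: eq_bigr => l _; rewrite mulr_sumr.
    by apply: eq_bigr => i _; rewrite rmorphM mulrA.
  under eq_bigr => a _ do rewrite (split3 a isT).
  rewrite big_split -mulr_sumr /= -[RHS]add0r; congr (_ + _).
  rewrite exchange_big big1 //= => l _; rewrite exchange_big big1 //= => i _.
  by rewrite -mulr_suml -rmorph_sum uc rmorph0 mul0r.
(* The term of smallest value in the vanishing combination determines its value. *)
have ex : exists a, [exists a' : 'I_n1, (val a' == a) && (u 0 a' != 0)].
  case/rV0Pn: u0 => a ua; exists (val a); apply/existsP; exists a.
  by rewrite eqxx.
have [_ /existsP[a /andP[/eqP <- ua]] mina] := ex_minnP ex.
pose r := \sum_(b | b != a) emb (u 0 b) * (w b / w a).
have mr : mO r.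
  apply: mO_sum => b ba; have [->|ub] := eqVneq (u 0 b) 0.
    by rewrite rmorph0 mul0r; exact: (phom0 homG).
  apply: mOM => //; apply: wlt; rewrite ltn_neqAle eq_sym val_eqE ba.
  by apply: mina; apply/existsP; exists b; rewrite eqxx.
have sumE : \sum_a emb (u 0 a) * w a = w a * (emb (u 0 a) + r).
  rewrite (bigD1 a) //= mulrDr mulrC mulr_sumr; congr (_ + _).
  by apply: eq_bigr => b _; rewrite [RHS]mulrCA [w a * (_ / _)]mulrC divfK.
have Gs : G (emb (u 0 a) + r, u 0 a).
  by rewrite -[X in G (_, X)]addr0; apply: (phomD homG) => //; exact: (phomC homG).
have s0 : emb (u 0 a) + r != 0.
  by apply: contra_neq ua => s0; rewrite s0 in Gs; exact: (phom_eq0 homG).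
pose q := (\sum_a emb (u 0 a) * y a) / (emb (u 0 a) + r).
have Oq : O q.
  apply: OM (place_inv Gs ua); apply/DO/rpred_sum => b _.
  by rewrite rpredM.
have waq : w a = z ^+ n2 * q by rewrite /q mulrA -sumw sumE mulfK.
have aJ : (a %/ N.+1 < J)%N by rewrite ltn_divLR // mulnC.
have mo : mO (z / f ^+ (a %% N.+1)) by apply: zf; rewrite -ltnS ltn_pmod.
apply: mO1.
have -> : 1 = z ^+ (J - (a %/ N.+1).+1) * q * y0 * (z / f ^+ (a %% N.+1)).
  apply: (mulfI (expf_neq0 (C + (a %/ N.+1).+1) z0)).
  have -> : z ^+ (C + (a %/ N.+1).+1) *
      (z ^+ (J - (a %/ N.+1).+1) * q * y0 * (z / f ^+ (a %% N.+1))) =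
      z ^+ n2 * q * (y0 * (z / f ^+ (a %% N.+1))).
    by rewrite /n2 -{2}(subnK aJ) !exprD; ring.
  rewrite -waq /w mulr1 exprD exprS zC; field.
  by rewrite ?f0 ?expf_neq0.
by apply: mOM => //; apply: OM; [apply: OM => //; exact/OX/mO_O | exact: DO].
Qed.

(** By [pow_mem_param], z = p^n y with p in the maximal ideal is possible only for
n <= N.  When n is largest, p is a uniformizer: if x had a smaller positive value,
then x or p / x would have at most half the value of p, and could replace it with
exponent 2 n. *)
Theorem uniformizer_ex : exists p, [/\ G (p, 0), p != 0,
    forall x, G (x, 0) -> exists y c, G (y, c) /\ x = p * y
  & forall x, exists j c, G (p ^+ j * x, c)].
Proof.
have bound n p : mO p -> (exists2 y, O y & z = p ^+ n * y) -> (n <= N)%N.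
  move=> mp [y Oy zp]; rewrite leqNgt; apply/negP => Nn; apply: mO1.
  have [y' Oy' pN] := pow_mem_param mp.
  have -> : 1 = y' * y * p ^+ (n - N.+1).+1.
    apply: (mulfI z0); rewrite mulr1 {1}zp -subSn // subSS -{1}(subnK (ltnW Nn)).
    by rewrite exprD pN; ring.
  by apply: mOM; [exact: OM | exact: mOX].
pose P n := `[< exists p, mO p /\ exists2 y, O y & z = p ^+ n * y >].
have exP : exists n, P n.
  by exists 1%N; apply/asboolP; exists z; split=> //; exists 1; rewrite ?expr1 ?mulr1.
have bP n : P n -> (n <= N)%N by case/asboolP => p [/bound]; apply.
have [n /asboolP[p [mp [y Oy zp]]] maxn] := ex_maxnP exP bP.
have n0 : (0 < n)%N.
  apply: maxn; apply/asboolP; exists z; split=> //.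
  by exists 1; rewrite ?expr1 ?mulr1.
have p0 : p != 0.
  by apply: contra_neq z0 => p0; rewrite zp p0 expr0n eqn0Ngt n0 mul0r.
have double q s : mO q -> O s -> p = q ^+ 2 * s -> False.
  move=> mq Os pE; suff : (n * 2 <= n)%N by rewrite leqNgt ltn_Pmulr.
  apply: maxn; apply/asboolP; exists q; split=> //; exists (s ^+ n * y).
    by apply: OM => //; exact: OX.
  by rewrite zp pE exprMn -exprM mulnC mulrA.
exists p; split=> // x.
  move=> mx; have [x0|x0] := eqVneq x 0.
    by exists 0, 0; rewrite mulr0; split=> //; exact: (phom0 homG).
  have [[c pxc]|] := valG (x / p).
    by exists (x / p), c; split=> //; rewrite mulrC divfK.
  rewrite invf_div => mpx; exfalso.
  have [[c yx]|] := valG (p / x / x).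
    by apply: (double x (p / x / x) mx); [exists c | field].
  rewrite invf_div => xy; apply: (double (p / x) (x / (p / x))) => //.
    by exists 0.
  by field; rewrite p0 x0.
have [a [b [aD bD b0 ->]]] := fracD x; have [j [w [wD zj]]] := zpow bD b0.
have [y' Oy' pN] := pow_mem_param mp; exists (N * j)%N.
have -> : p ^+ (N * j) * (a / b) = w * y' ^+ j * a.
  by rewrite exprM pN exprMn zj; field.
by apply: OM; [apply: OM; [exact: DO | exact: OX] | exact: DO].
Qed.

End Uniformizer.

(** * Expansion in powers of a uniformizer *)

Section Expansion.
Variables (k : closedFieldType) (F : fieldType) (emb : {rmorphism k -> F}).
Variable G : set (F * k).
Hypothesis homG : partial_hom emb G.
Variable p : F.
Hypothesis p0 : p != 0.
Hypothesis mp : G (p, 0).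
Hypothesis divp : forall x, G (x, 0) -> exists y c, G (y, c) /\ x = p * y.
Hypothesis archp : forall x, exists j c, G (p ^+ j * x, c).

Let O : set F := [set x | exists c, G (x, c)].

Let OD x y : O x -> O y -> O (x + y).
Proof. by move=> [a xa] [b yb]; exists (a + b); exact: (phomD homG). Qed.
Let OM x y : O x -> O y -> O (x * y).
Proof. by move=> [a xa] [b yb]; exists (a * b); exact: (phomM homG). Qed.
Let Op : O p. Proof. by exists 0. Qed.

Definition residue (x : F) : k := xget 0 [set c | G (x, c)].

Lemma residueP x : O x -> G (x, residue x).
Proof. by move=> Ox; apply: (xgetPex 0 Ox). Qed.

Lemma residueE x c : G (x, c) -> residue x = c.
Proof. by move=> xc; apply: (phom_fun homG _ xc); apply: residueP; exists c. Qed.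

(** Removal of the first term of the expansion; it is a derivation twisted by the
residue ([shiftM]), as is the shift of power series, which makes [expansion]
multiplicative. *)
Definition shift (x : F) : F := (x - emb (residue x)) / p.

Lemma O_shift x : O x -> O (shift x).
Proof.
move=> /residueP xr; have /divp[y [c [yc xE]]] : G (x - emb (residue x), 0).
  by rewrite -[X in G (_, X)](subrr (residue x)); apply: (phomB homG) => //; exact: (phomC homG).
by exists c; rewrite /shift xE mulrC mulKf.
Qed.

Lemma shiftB x y : O x -> O y -> shift (x - y) = shift x - shift y.
Proof.
move=> /residueP xr /residueP yr; rewrite /shift (residueE (phomB homG xr yr)).
by rewrite rmorphB; field.
Qed.

Lemma shiftM x y : O x -> O y ->
  shift (x * y) = emb (residue x) * shift y + shift x * y.
Proof.
move=> /residueP xr /residueP yr; rewrite /shift (residueE (phomM homG xr yr)).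
by rewrite rmorphM; field.
Qed.

Definition expansion (x : F) : fps k := FPS (fun i => residue (iter i shift x)).

Lemma residueB x y : O x -> O y -> residue (x - y) = residue x - residue y.
Proof. by move=> /residueP xr /residueP yr; rewrite (residueE (phomB homG xr yr)). Qed.
Lemma residueM x y : O x -> O y -> residue (x * y) = residue x * residue y.
Proof. by move=> /residueP xr /residueP yr; rewrite (residueE (phomM homG xr yr)). Qed.

Lemma expansionB x y : O x -> O y -> expansion (x - y) = expansion x - expansion y.
Proof.
move=> Ox Oy; apply/fpsP => i /=; elim: i x y Ox Oy => [|i IH] x y Ox Oy.
  exact: residueB.
by rewrite !iterSr shiftB // IH //; exact: O_shift.
Qed.

Lemma expansionD x y : O x -> O y -> expansion (x + y) = expansion x + expansion y.
Proof.
move=> Ox Oy; rewrite -[x in RHS](addrK y) expansionB ?subrK //.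
exact: OD.
Qed.

Lemma expansion_emb c x : O x -> expansion (emb c * x) = c *: expansion x.
Proof.
move=> Ox; apply/fpsP => i /=; elim: i x Ox => [|i IH] x Ox.
  by rewrite /= residueM // ?(residueE (phomC homG c)) //; exists c; exact: (phomC homG).
rewrite !iterSr -IH; last exact: O_shift.
congr (residue (iter i shift _)); rewrite /shift residueM //.
  by rewrite (residueE (phomC homG c)) rmorphM; field.
by exists c; exact: (phomC homG).
Qed.

Lemma expansionM x y : O x -> O y -> expansion (x * y) = expansion x * expansion y.
Proof.
move=> Ox Oy; apply/fpsP => i /=; elim: i x y Ox Oy => [|i IH] x y Ox Oy.
  by rewrite big_ord1 subnn /= residueM.
have [Osx Osy] := (O_shift Ox, O_shift Oy).
have Or : O (emb (residue x)) by exists (residue x); exact: (phomC homG).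
transitivity (fps_coef (expansion (emb (residue x) * shift y + shift x * y)) i).
  by rewrite iterSr shiftM.
rewrite expansionD; [|exact: OM|exact: OM].
rewrite expansion_emb // big_ord_recl subn0 /= -iterS iterSr; congr (_ + _).
by rewrite IH //; apply: eq_bigr => j _; rewrite -iterSr.
Qed.

Definition fps_t : fps k := FPS (fun i => (i == 1)%:R).

Lemma fps_t_neq0 : fps_t != 0.
Proof. by apply/eqP => /fpsP/(_ 1%N) /= /eqP; rewrite oner_eq0. Qed.

Lemma residue0 : residue 0 = 0. Proof. exact: residueE (phom0 homG). Qed.
Lemma shift0 : shift 0 = 0. Proof. by rewrite /shift residue0 rmorph0 subrr mul0r. Qed.
Lemma residue1 : residue 1 = 1. Proof. exact: residueE (phom1 homG). Qed.

Lemma expansion1 : expansion 1 = 1.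
Proof.
apply/fpsP => -[|i] /=; first exact: residue1.
rewrite -iterS iterSr {2}/shift residue1 rmorph1 subrr mul0r.
by elim: i => [|i IH]; [exact: residue0 | rewrite iterSr shift0].
Qed.

Lemma expansion_p : expansion p = fps_t.
Proof.
apply/fpsP => -[|i] /=; first exact: residueE mp.
rewrite -iterS iterSr {2}/shift (residueE mp) rmorph0 subr0 divff //.
by have /fpsP/(_ i) := expansion1.
Qed.

Lemma expansionX x j : O x -> expansion (x ^+ j) = expansion x ^+ j.
Proof.
move=> Ox; elim: j => [|j IH]; first exact: expansion1.
rewrite !exprS expansionM ?IH //.
elim: j {IH} => [|j IH]; first by exists 1; exact: (phom1 homG).
by rewrite exprS; apply: OM.
Qed.

Let T : laurent k := laurent_of_fps fps_t.

Let T0 : T != 0.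
Proof. by rewrite /T /laurent_of_fps tofrac_eq0 fps_t_neq0. Qed.

(** The value does not depend on the exponent j that makes p^j x integral
([laurent_expansionE]). *)
Definition laurent_expansion (x : F) : laurent k :=
  let j := sval (cid (archp x)) in laurent_of_fps (expansion (p ^+ j * x)) / T ^+ j.

Lemma laurent_expansionE x j : O (p ^+ j * x) ->
  laurent_expansion x = laurent_of_fps (expansion (p ^+ j * x)) / T ^+ j.
Proof.
rewrite /laurent_expansion; case: cid => /= i Oi Oj.
have OX n : O (p ^+ n) by exists (0 ^+ n); exact: (phomX homG).
have shiftX n : expansion (p ^+ n) = fps_t ^+ n by rewrite expansionX ?expansion_p.
apply/eqP; rewrite eqr_div ?expf_neq0 // /T -!rmorphXn -!rmorphM; apply/eqP.
congr (laurent_of_fps _).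
rewrite -!shiftX -!expansionM //; congr expansion; ring.
Qed.

Lemma laurent_expansion_int x : O x -> laurent_expansion x = laurent_of_fps (expansion x).
Proof.
move=> Ox; rewrite (@laurent_expansionE x 0) expr0 mul1r // invr1 ?mulr1 //.
Qed.

Let O_le i j x : (i <= j)%N -> O (p ^+ i * x) -> O (p ^+ j * x).
Proof.
move=> ij Ox; rewrite -(subnK ij) exprD -mulrA; apply: OM => //.
by exists (0 ^+ (j - i)); exact: (phomX homG).
Qed.

Fact laurent_expansion_zmod : zmod_morphism laurent_expansion.
Proof.
move=> x y; have [[i Oi] [j Oj]] := (archp x, archp y).
have {}Oi := O_le (leq_addr j i) Oi; have {}Oj := O_le (leq_addl i j) Oj.
rewrite (laurent_expansionE Oi) (laurent_expansionE Oj).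
have Oxy : O (p ^+ (i + j) * (x - y)).
  rewrite mulrBr; apply: OD => //; case: Oj => c yc; exists (- c); exact: (phomN homG).
by rewrite (laurent_expansionE Oxy) mulrBr expansionB // rmorphB mulrBl.
Qed.

Fact laurent_expansion_monoid : monoid_morphism laurent_expansion.
Proof.
split.
  rewrite laurent_expansion_int ?expansion1 ?rmorph1 //.
  by exists 1; exact: (phom1 homG).
move=> x y; have [[i Oi] [j Oj]] := (archp x, archp y).
rewrite (laurent_expansionE Oi) (laurent_expansionE Oj).
have Exy : p ^+ (i + j) * (x * y) = (p ^+ i * x) * (p ^+ j * y) by rewrite exprD; ring.
have Oxy : O (p ^+ (i + j) * (x * y)) by rewrite Exy; apply: OM.
rewrite (laurent_expansionE Oxy) Exy expansionM // rmorphM exprD.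
by rewrite invfM mulrACA.
Qed.

HB.instance Definition _ := GRing.isZmodMorphism.Build F (laurent k)
  laurent_expansion laurent_expansion_zmod.
HB.instance Definition _ := GRing.isMonoidMorphism.Build F (laurent k)
  laurent_expansion laurent_expansion_monoid.

Lemma expansion_hom : exists Phi : {rmorphism F -> laurent k},
  (forall c, Phi (emb c) = laurent_of_fps c%:A) /\
  forall x c, G (x, c) -> exists s, Phi x = laurent_of_fps s /\ fps_coef s 0 = c.
Proof.
exists laurent_expansion; split=> [c|x c xc].
  rewrite /= laurent_expansion_int; last by exists c; exact: (phomC homG).
  rewrite -[emb c]mulr1 expansion_emb ?expansion1 //.
  by exists 1; exact: (phom1 homG).
exists (expansion x); rewrite /= laurent_expansion_int; last by exists c.
by rewrite (residueE xc).
Qed.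

End Expansion.

(** When the residue map is injective there is no uniformizer, and the arc is
constant. *)
Lemma trivial_place_hom (k : closedFieldType) (F : fieldType)
    (emb : {rmorphism k -> F}) (G : set (F * k)) :
    partial_hom emb G ->
    (forall f, (exists c, G (f, c)) \/ G (f^-1, 0)) ->
    (forall x, G (x, 0) -> x = 0) ->
  exists Phi : {rmorphism F -> laurent k},
  (forall c, Phi (emb c) = laurent_of_fps c%:A) /\
  forall x c, G (x, c) -> exists s, Phi x = laurent_of_fps s /\ fps_coef s 0 = c.
Proof.
move=> homG valG m0.
have allG x : exists c, G (x, c).
  have [//|/m0/eqP] := valG x; rewrite invr_eq0 => /eqP ->.
  by exists 0; exact: (phom0 homG).
have /choice[r rP] := allG.
pose f x : laurent k := laurent_of_fps (r x)%:A.
have rE x c : G (x, c) -> r x = c by move=> xc; exact: (phom_fun homG (rP x) xc).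
have f_zmod : zmod_morphism f.
  by move=> x y; rewrite /f (rE _ _ (phomB homG (rP x) (rP y))) scalerBl rmorphB.
have f_mon : monoid_morphism f.
  split=> [|x y]; first by rewrite /f (rE _ _ (phom1 homG)) scale1r rmorph1.
  by rewrite /f (rE _ _ (phomM homG (rP x) (rP y))) -rmorphM -scalerAl mul1r scalerA.
pose Phi : {rmorphism F -> laurent k} := HB.pack f
  (GRing.isZmodMorphism.Build F (laurent k) f f_zmod)
  (GRing.isMonoidMorphism.Build F (laurent k) f f_mon).
exists Phi; split=> [c|x c xc]; first by rewrite /= /f (rE _ _ (phomC homG c)).
by exists (r x)%:A; split=> //=; rewrite (rE _ _ xc) mulr1.
Qed.

(** * From places to Laurent points *)

Section LocalPart.
Variables (k : closedFieldType) (F : fieldType) (emb : {rmorphism k -> F}).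
Variable G : set (F * k).
Hypothesis homG : partial_hom emb G.
Hypothesis valG : forall f, (exists c, G (f, c)) \/ G (f^-1, 0).
Variable T : subringClosed F.
Hypothesis TO : forall t, t \in T -> exists c, G (t, c).

Definition local_part : {pred F} :=
  fun f => `[< exists s t, [/\ s \in T, t \in T, ~ G (t, 0) & f = s / t] >].

Lemma local_partP f : reflect
  (exists s t, [/\ s \in T, t \in T, ~ G (t, 0) & f = s / t]) (f \in local_part).
Proof. exact: asboolP. Qed.

Lemma notin_max_neq0 t : ~ G (t, 0) -> t != 0.
Proof. by apply: contra_notN => /eqP ->; exact: (phom0 homG). Qed.

Lemma notin_maxV t c : G (t, c) -> ~ G (t, 0) -> exists c', G (t^-1, c').
Proof. by move=> tc nt; apply: (place_inv homG valG tc); apply: contra_notN nt => /eqP <-. Qed.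

Lemma notin_maxM s t c : G (s, c) -> ~ G (s, 0) -> ~ G (t, 0) -> ~ G (s * t, 0).
Proof.
move=> sc ns nt nst; have [c' s'] := notin_maxV sc ns; apply: nt.
by rewrite -[t](mulKf (notin_max_neq0 ns)) -(mulr0 c'); apply: (phomM homG).
Qed.

Fact local_part_subring : subring_closed local_part.
Proof.
have n1 : ~ G (1, 0).
  by move=> /(phom_fun homG)/(_ (phom1 homG))/esym/eqP; rewrite oner_eq0.
split.
- by apply/local_partP; exists 1, 1; rewrite rpred1 divr1.
- move=> _ _ /local_partP[a [s [aT sT ns ->]]] /local_partP[b [t [bT tT nt ->]]].
  have [[c sc] [c' tc]] := (TO sT, TO tT).
  apply/local_partP; exists (a * t - b * s), (s * t).
  rewrite rpredB ?rpredM //; split=> //; first exact: notin_maxM sc ns nt.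
  by field; rewrite !notin_max_neq0.
- move=> _ _ /local_partP[a [s [aT sT ns ->]]] /local_partP[b [t [bT tT nt ->]]].
  have [c sc] := TO sT.
  apply/local_partP; exists (a * b), (s * t).
  rewrite !rpredM //; split=> //; first exact: notin_maxM sc ns nt.
  by rewrite mulf_div.
Qed.

Lemma sub_local_part t : t \in T -> t \in local_part.
Proof.
move=> tT; apply/local_partP; exists t, 1; rewrite rpred1 divr1; split=> //.
by move=> /(phom_fun homG)/(_ (phom1 homG))/esym/eqP; rewrite oner_eq0.
Qed.

Lemma local_partO f : f \in local_part -> exists c, G (f, c).
Proof.
case/local_partP=> s [t [sT tT nt ->]]; have [[c sc] [c' tc]] := (TO sT, TO tT).
by have [c'' tV] := notin_maxV tc nt; exists (c * c''); apply: (phomM homG).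
Qed.

Lemma local_partV f : f \in local_part -> ~ G (f, 0) -> f^-1 \in local_part.
Proof.
case/local_partP=> s [t [sT tT nt ->]] nst; apply/local_partP; exists t, s.
split=> //; last by rewrite invf_div.
move=> ns; apply: nst; have [c tc] := TO tT; have [c' tV] := notin_maxV tc nt.
by rewrite -(mul0r c'); apply: (phomM homG).
Qed.

End LocalPart.

(** [x] stands for the coordinates of the generic point of a closed set, [be] for those
of its image and [y] for a point in the closure of the image; the last hypothesis
says that no smaller closed set has [y] in the closure of its image. *)
Lemma mpoly_eval_laurent (k : closedFieldType) (F : fieldType)
    (emb : {rmorphism k -> F}) n (x : 'I_n -> F) l (be : 'I_l -> F) (y : 'I_l -> k) :
    (forall f, exists p q, mmap emb x q != 0 /\ f = mmap emb x p / mmap emb x q) ->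
    (forall q, mmap emb be q = 0 -> q.@[y] = 0) ->
    (forall p, mmap emb x p != 0 -> exists p' q,
      q.@[y] != 0 /\ mmap emb x p * mmap emb x p' = mmap emb be q) ->
  exists Phi : {rmorphism F -> laurent k},
    (forall c, Phi (emb c) = laurent_of_fps c%:A) /\
    forall j, exists s, Phi (be j) = laurent_of_fps s /\ fps_coef s 0 = y j.
Proof.
move=> Fgen be_y x_be.
pose G0 : set (F * k) := [set fc | exists q, fc = (mmap emb be q, q.@[y])].
have homG0 : partial_hom emb G0.
  split.
  - by move=> c; exists c%:MP; rewrite mmapC mevalC.
  - by move=> _ _ _ _ [p [-> ->]] [q [-> ->]]; exists (p - q); rewrite rmorphB mevalB.
  - by move=> _ _ _ _ [p [-> ->]] [q [-> ->]]; exists (p * q); rewrite rmorphM mevalM.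
  - by move=> c [q [/esym/be_y q0 ->]].
have [G [G0G homG valG]] := place_ex homG0.
have Gbe q : G (mmap emb be q, q.@[y]) by apply: G0G; exists q.
suff [Phi [Phi_emb Phi_G]] : exists Phi : {rmorphism F -> laurent k},
    (forall c, Phi (emb c) = laurent_of_fps c%:A) /\
    forall x c, G (x, c) -> exists s, Phi x = laurent_of_fps s /\ fps_coef s 0 = c.
  exists Phi; split=> // j; apply: Phi_G.
  by have := Gbe 'X_j; rewrite mmapX mmap1U mevalXU.
have [m0|mn0] := pselect (forall f, G (f, 0) -> f = 0).
  exact: trivial_place_hom m0.
(* Every coordinate or its inverse is in O; subtracting residues puts the chosen
   elements into the maximal ideal. *)
have /choice[u uP] i : exists ui : F, G (ui, 0) /\
    ((exists c, x i = ui + emb c) \/ (x i != 0 /\ ui = (x i)^-1)).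
  have [[c xc]|xV] := valG (x i).
    exists (x i - emb c); split; last by left; exists c; rewrite subrK.
    by rewrite -(subrr c); apply: (phomB homG) => //; exact: (phomC homG).
  have [x0|x0] := eqVneq (x i) 0.
    by exists 0; split; [exact: (phom0 homG) | left; exists 0; rewrite x0 rmorph0 addr0].
  by exists (x i)^-1; split=> //; right.
pose gam := [seq u i | i <- enum 'I_n] ++ [seq be j - emb (y j) | j <- enum 'I_l].
pose K : subringClosed F := scalars emb.
pose T := adjoins K gam.
have Gspl c f : G (f, c) -> G (f - emb c, 0).
  by move=> fc; rewrite -(subrr c); apply: (phomB homG) => //; exact: (phomC homG).
have gamG a : a \in gam -> G (a, 0).
  rewrite mem_cat => /orP[/mapP[i _ ->]|/mapP[j _ ->]]; first by case: (uP i).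
  by apply: Gspl; have := Gbe 'X_j; rewrite mmapX mmap1U mevalXU.
have TO t : t \in T -> exists c, G (t, c).
  pose S0 : {pred F} := fun f => `[< exists c, G (f, c) >].
  have S0sub : subring_closed S0.
    split; first by apply/asboolP; exists 1; exact: (phom1 homG).
      move=> a b /asboolP[c ac] /asboolP[c' bc]; apply/asboolP; exists (c - c').
      exact: (phomB homG).
    move=> a b /asboolP[c ac] /asboolP[c' bc]; apply/asboolP; exists (c * c').
    exact: (phomM homG).
  pose S : subringClosed F := HB.pack S0 (GRing.isSubringClosed.Build F S0 S0sub).
  move=> tT; suff : t \in S by move/asboolP.
  apply: adjoins_min tT => a => [/scalarsP[c ->]|/gamG aG]; apply/asboolP.
    by exists c; exact: (phomC homG).
  by exists 0.
pose D : subringClosed F := HB.pack (local_part G T)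
  (GRing.isSubringClosed.Build F _ (local_part_subring homG valG TO)).
have TD t : t \in T -> t \in D by exact: (sub_local_part homG).
have DO f : f \in D -> exists c, G (f, c) by exact: (local_partO homG valG TO).
have DV f : f \in D -> ~ G (f, 0) -> f^-1 \in D by exact: (local_partV homG valG TO).
pose m : set F := [set f | f \in D /\ G (f, 0)].
have embT c : emb c \in T by apply/sub_adjoins/mem_scalars.
have gamT a : a \in gam -> a \in T by exact: mem_adjoins.
have msub : submod D m.
  split; first by split; [exact: rpred0 | exact: (phom0 homG)].
    move=> f g [fD fG] [gD gG]; split; first exact: rpredD.
    by rewrite /= -(addr0 0); apply: (phomD homG).
  move=> a f aD [fD fG]; split; first exact: rpredM.
  by have [c ac] := DO a aD; rewrite /= -(mulr0 c); apply: (phomM homG).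
have mD f : m f -> f \in D by case.
have m1 : ~ m 1.
  by case=> _ /(phom_fun homG)/(_ (phom1 homG))/esym/eqP; rewrite oner_eq0.
have Dloc f : f \in D -> ~ m f -> f^-1 \in D.
  by move=> fD nf; apply: DV => // fG; apply: nf.
have DT f : f \in D -> exists2 s, s \in T /\ ~ m s & s * f \in T.
  case/local_partP=> s [t [sT tT nt ->]]; exists t; first by split=> // -[].
  by rewrite mulrC divfK // (notin_max_neq0 homG).
have Dres f : f \in D -> exists c, m (f - emb c).
  move=> fD; have [c fc] := DO f fD; exists c; split; last exact: Gspl.
  by rewrite rpredB // TD.
have mgam a : a \in gam -> m a.
  by move=> ag; split; [exact/TD/gamT | exact: gamG].
have mgen f : m f -> mspan D gam f.
  have [S0 SD SM] := mspan_submod D gam.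
  have Tspan t : t \in T -> exists c, mspan D gam (t - emb c).
    pose P0 : {pred F} := fun t => (t \in D) && `[< exists c, mspan D gam (t - emb c) >].
    have P0sub : subring_closed P0.
      split.
      - apply/andP; split; first exact: rpred1.
        by apply/asboolP; exists 1; rewrite rmorph1 subrr; exact: S0.
      - move=> a b /andP[aD /asboolP[c ac]] /andP[bD /asboolP[c' bc]].
        apply/andP; split; [exact: rpredB | apply/asboolP; exists (c - c')].
        have -> : a - b - emb (c - c') = (a - emb c) + (-1) * (b - emb c').
          by rewrite rmorphB; ring.
        by apply: SD => //; apply: SM => //; rewrite rpredN rpred1.
      - move=> a b /andP[aD /asboolP[c ac]] /andP[bD /asboolP[c' bc]].
        apply/andP; split; [exact: rpredM | apply/asboolP; exists (c * c')].
        have -> : a * b - emb (c * c') = a * (b - emb c') + emb c' * (a - emb c).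
          by rewrite rmorphM; ring.
        by apply: SD; apply: SM => //; exact: TD.
    pose P : subringClosed F := HB.pack P0 (GRing.isSubringClosed.Build F P0 P0sub).
    move=> tT; suff : t \in P by case/andP=> _ /asboolP.
    apply: adjoins_min tT => a => [/scalarsP[c ->]|ag]; apply/andP.
      by split; [exact: TD | apply/asboolP; exists c; rewrite subrr; exact: S0].
    split; first exact/TD/gamT.
    by apply/asboolP; exists 0; rewrite rmorph0 subr0; exact: mspan_mem.
  case=> /local_partP[s [t [sT tT nt ->]]] stG.
  have [c sc] := Tspan s sT.
  have sG : G (s, 0).
    have [c' tc'] := TO t tT; rewrite -(divfK (notin_max_neq0 homG nt) s) -(mul0r c').
    exact: (phomM homG).
  have c0 : c = 0.
    have [_ scG] : m (s - emb c) by apply: (sc m) => // a /mgam.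
    have := phomB homG sG scG; rewrite opprB addrC subrK subr0.
    by move=> /(phom_fun homG)/(_ (phomC homG c)).
  rewrite c0 rmorph0 subr0 in sc.
  rewrite mulrC; apply: SM => //; apply: DV => //; exact: TD.
have beT j : be j \in T.
  rewrite -(subrK (emb (y j)) (be j)) rpredD // gamT // mem_cat.
  by apply/orP; right; apply: map_f; rewrite mem_enum.
have uT i : u i \in T.
  by rewrite gamT // mem_cat; apply/orP; left; apply: map_f; rewrite mem_enum.
(* b is the product of the inverses of those coordinates that are not in O. *)
have /choice[v vP] i : exists vi, [/\ vi \in T, vi != 0 & vi * x i \in T].
  have [_ [[c xi]|[x0 ui]]] := uP i.
    by exists 1; rewrite rpred1 oner_neq0 mul1r xi rpredD.
  by exists (u i); rewrite uT {1}ui invr_eq0 x0 ui mulVf // rpred1.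
pose b := \prod_i v i.
have bT : b \in T by apply: rpred_prod => i _; case: (vP i).
have b0 : b != 0 by apply/prodf_neq0 => i _; case: (vP i).
have bx p : exists N, b ^+ N * mmap emb x p \in D.
  elim/mpoly_ring_ind: p => [c|i|p q [N pN] [N' qN']|p q [N pN] [N' qN']].
  - by exists 0%N; rewrite mul1r mmapC; exact/TD/embT.
  - exists 1%N; rewrite expr1 mmapX mmap1U /b (bigD1 i) //= mulrAC TD // rpredM //.
      by case: (vP i).
    by apply: rpred_prod => j _; case: (vP j).
  - exists (N + N')%N; rewrite rmorphD.
    have -> : b ^+ (N + N') * (mmap emb x p + mmap emb x q) =
        b ^+ N' * (b ^+ N * mmap emb x p) + b ^+ N * (b ^+ N' * mmap emb x q).
      by rewrite exprD; ring.
    by rewrite rpredD // rpredM // rpredX // TD.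
  - exists (N + N')%N; rewrite rmorphM.
    have -> : b ^+ (N + N') * (mmap emb x p * mmap emb x q) =
        (b ^+ N * mmap emb x p) * (b ^+ N' * mmap emb x q).
      by rewrite exprD; ring.
    by rewrite rpredM.
have bF f : exists N, b ^+ N * f \in D.
  have [p [q [q0 ->]]] := Fgen f; have [p' [r [r0 qr]]] := x_be q q0.
  have [N pN] := bx (p * p'); exists N.
  have rD : (mmap emb be r)^-1 \in D.
    apply: DV; first by apply/TD/mmap_mem.
    by move=> /(phom_fun homG)/(_ (Gbe r))/esym/eqP; apply/negP.
  have r0' : mmap emb be r != 0.
    apply: contra_neq r0; exact: be_y.
  have p'0 : mmap emb x p' != 0.
    by apply: contra_neq r0' => p'0; rewrite -qr p'0 mulr0.
  have -> : b ^+ N * (mmap emb x p / mmap emb x q) =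
      b ^+ N * mmap emb x (p * p') / mmap emb be r.
    by rewrite -qr rmorphM; field; rewrite q0 p'0.
  by rewrite rpredM.
have bpow f : f \in D -> f != 0 -> exists N g, g \in D /\ b ^+ N = f * g.
  move=> fD f0; have [N fN] := bF f^-1; exists N, (b ^+ N * f^-1); split=> //.
  by rewrite mulrCA divff // mulr1.
have fracD f : exists a c, [/\ a \in D, c \in D, c != 0 & f = a / c].
  have [N fN] := bF f; exists (b ^+ N * f), (b ^+ N).
  split=> //; [by rewrite rpredX // TD | by rewrite expf_neq0 |].
  by rewrite mulrAC divff ?mul1r ?expf_neq0.
have embD c : emb c \in D by exact: TD.
have [m0|[z [mz z0 zpow [N [e eP]]]]] :=
    dimension_le1 TD DT msub mD m1 Dloc Dres mgam mgen (TD _ bT) b0 bpow.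
  case: mn0 => f fG; have [a [c [aD cD c0 fE]]] := fracD f.
  rewrite fE (m0 a) ?mul0r //; split=> //.
  have [c' cc'] := DO c cD; rewrite -[a](divfK c0) -fE -(mul0r c').
  exact: (phomM homG).
have [p [mp p0 divp archp]] :=
  uniformizer_ex homG valG embD DO fracD z0 mz.2 mz.1 zpow eP.
exact: (expansion_hom homG p0 mp divp archp).
Qed.

(** It suffices to replace [P0] by a maximal ideal among those satisfying the same
condition, and to work in the fraction field of the quotient. *)
Lemma mpoly_laurent (k : closedFieldType) n l (P0 : set {mpoly k[n]})
    (b : 'I_l -> {mpoly k[n]}) (y : 'I_l -> k) :
    is_ideal P0 ->
    (forall q, P0 (mmap (@mpolyC n k) b q) -> q.@[y] = 0) ->
  exists (g : 'I_n -> laurent k) (s : 'I_l -> fps k),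
    let ev := mmap (@laurent_of_fps k \o @fps_of_scalar k) g in
    [/\ forall p, P0 p -> ev p = 0,
        forall j, ev (b j) = laurent_of_fps (s j)
      & forall j, fps_coef (s j) 0 = y j].
Proof.
move=> idP0 P0y.
pose good (P : set {mpoly k[n]}) :=
  is_ideal P /\ forall q, P (mmap (@mpolyC n k) b q) -> q.@[y] = 0.
have [|P [P0P [[PZ PD PM] Py] maxP]] := @Zorn_above _ good P0 (conj idP0 P0y).
  move=> C [A CA] Cgood totC; split; last by move=> q [B CB]; apply: (Cgood B CB).2.
  split.
  - by exists A => //; case: (Cgood A CA) => -[].
  - move=> p q [B CB Bp] [B' CB' B'q]; have [BB|BB] := totC _ _ CB CB'.
      by exists B' => //; case: (Cgood B' CB') => -[_ + _] _; apply=> //; exact: BB.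
    by exists B => //; case: (Cgood B CB) => -[_ + _] _; apply=> //; exact: BB.
  - by move=> p q [B CB Bq]; exists B => //; case: (Cgood B CB) => -[_ _ +] _; apply.
(* By maximality the ideal generated by P and an element outside P violates the
   condition. *)
have maxE a : ~ P a -> exists r q, q.@[y] != 0 /\ P (mmap (@mpolyC n k) b q - r * a).
  move=> nPa; apply: contrapT => nex; apply: nPa.
  pose P' : set {mpoly k[n]} := [set f | exists r, P (f - r * a)].
  apply: (maxP P'); last by exists 1; rewrite mul1r subrr.
    by move=> f Pf; exists 0; rewrite mul0r subr0.
  split; first split.
  - by exists 0; rewrite mul0r subrr.
  - move=> f g [r fr] [r' gr]; exists (r + r').
    have -> : f + g - (r + r') * a = (f - r * a) + (g - r' * a) by ring.
    exact: PD.
  - move=> f g [r gr]; exists (f * r).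
    have -> : f * g - f * r * a = f * (g - r * a) by ring.
    exact: PM.
  - move=> q [r Pr]; apply/eqP; apply: contrapT => /negP qy.
    by apply: nex; exists r, q.
have P1 : ~ P 1.
  move=> P1; have := Py 1; rewrite rmorph1 meval1 => /(_ P1)/eqP.
  by rewrite oner_eq0.
have [||F [h [hP hfrac]]] := @prime_ideal_field _ P PZ P1.
- by move=> a u v Pu Pv; apply: PD => //; exact: PM.
- move=> u v Puv; apply: contrapT => /not_orP[/maxE[r [q [qy Pr]]] /maxE[r' [q' [q'y Pr']]]].
  have := Py (q * q'); rewrite mevalM rmorphM /=.
  set Q := mmap _ _ q; set Q' := mmap _ _ q' => qq'.
  suff /qq'/eqP : P (Q * Q') by rewrite mulf_eq0 (negbTE qy) (negbTE q'y).
  have -> : Q * Q' = Q' * (Q - r * u) + (r * u) * (Q' - r' * v) + (r * r') * (u * v) by ring.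
  by apply: (PD); [apply: (PD)|]; exact: PM.
pose emb : {rmorphism k -> F} := h \o @mpolyC n k.
pose x i := h 'X_i.
have hE p : mmap emb x p = h p.
  elim/mpoly_ring_ind: p => [c|i|p q pE qE|p q pE qE].
  - by rewrite mmapC.
  - by rewrite mmapX mmap1U.
  - by rewrite !rmorphD /= pE qE.
  - by rewrite !rmorphM /= pE qE.
have hbE q : mmap emb (h \o b) q = h (mmap (@mpolyC n k) b q) by rewrite mmap_comp.
have [|||Phi [Phi_emb Phi_be]] := @mpoly_eval_laurent k F emb n x l (h \o b) y.
- by move=> f; have [p [q [q0 ->]]] := hfrac f; exists p, q; rewrite !hE.
- by move=> q; rewrite hbE => /hP/Py.
- move=> p; rewrite hE => hp; have /maxE[r [q [qy Pr]]] : ~ P p.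
    by move/hP/eqP; rewrite (negbTE hp).
  exists r, q; split=> //; rewrite hE hbE -rmorphM; apply/esym/eqP.
  by rewrite -subr_eq0 -rmorphB [p * r]mulrC; apply/eqP/hP.
have /choice[s sP] := Phi_be.
exists (Phi \o x), s.
have evE p :
    mmap (@laurent_of_fps k \o @fps_of_scalar k) (Phi \o x) p = Phi (h p).
  elim/mpoly_ring_ind: p => [c|i|p q pE qE|p q pE qE].
  - by rewrite mmapC; exact/esym/Phi_emb.
  - by rewrite mmapX mmap1U.
  - by rewrite !rmorphD /= pE qE.
  - by rewrite !rmorphM /= pE qE.
split=> [p Pp|j|j] /=; rewrite ?evE; [|by case: (sP j)..].
by rewrite (hP p).2 ?rmorph0 //; exact: P0P.
Qed.

Lemma eq_mmap (R C : comNzRingType) (h h' : R -> C) n (v : 'I_n -> C) p :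
  h =1 h' -> mmap h v p = mmap h' v p.
Proof. by move=> hh'; apply: eq_bigr => m _; rewrite hh'. Qed.

(** * Points of affine varieties and orbits *)

Section EvalPoints.
Variables (k : closedFieldType) (X : affvar k).

Lemma coord_ring_poly (f : coord_ring X) : exists p, f = poly_fun X p.
Proof. by have /asboolP[p fp] := cr_regular f; exists p; apply/cr_eqP. Qed.

Lemma points_coord (A : comAlgType k) (s : points X A) p :
  s (poly_fun X p) = mmap (GRing.in_alg A) (fun j => s (poly_fun X 'X_j)) p.
Proof.
elim/mpoly_ring_ind: p => [c|i|p q pE qE|p q pE qE].
- rewrite mmapC /= -(rmorph1 s) -linearZ; congr (s _).
  by apply/cr_eqP => v; rewrite poly_funE mevalC cr_scaleE mulr1.
- by rewrite mmapX mmap1U.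
- rewrite rmorphD /= -pE -qE -rmorphD; congr (s _).
  by apply/cr_eqP => v; rewrite cr_addE !poly_funE mevalD.
- rewrite rmorphM /= -pE -qE -rmorphM; congr (s _).
  by apply/cr_eqP => v; rewrite cr_mulE !poly_funE mevalM.
Qed.

Lemma points_ext (A : comAlgType k) (s t : points X A) :
  (forall j, s (poly_fun X 'X_j) = t (poly_fun X 'X_j)) -> s = t.
Proof.
move=> st; apply/pointsP => f; have [p ->] := coord_ring_poly f.
by rewrite !points_coord; congr (mmap _ _ p); apply/funext.
Qed.

Definition vanishing : set {mpoly k[av_dim X]} :=
  [set p | forall v : av_pt X, p.@[val v] = 0].

Lemma vanishing_ideal : is_ideal vanishing.
Proof.
split=> [v|p q pX qX v|p q qX v]; rewrite ?meval0 //.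
  by rewrite mevalD pX qX addr0.
by rewrite mevalM qX mulr0.
Qed.

Lemma mem_vanishing (v : 'I_(av_dim X) -> k) :
  (forall p, vanishing p -> p.@[v] = 0) -> av_set X v.
Proof.
have [I _ XI] := av_closed X.
have {}XI w : av_set X w = zero_locus I w by rewrite XI.
rewrite XI => pv p Ip; apply: pv => u.
have : av_set X (val u) by exact: set_mem (valP u).
by rewrite XI; apply.
Qed.

Lemma points_of_coord (A : comAlgType k) (v : 'I_(av_dim X) -> A) :
    (forall p, vanishing p -> mmap (GRing.in_alg A) v p = 0) ->
  exists s : points X A, forall p, s (poly_fun X p) = mmap (GRing.in_alg A) v p.
Proof.
move=> vX; have /choice[r rP] := coord_ring_poly.
pose s f := mmap (GRing.in_alg A) v (r f).
have sP p : s (poly_fun X p) = mmap (GRing.in_alg A) v p.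
  apply/eqP; rewrite -subr_eq0 -rmorphB; apply/eqP/vX => u.
  by rewrite mevalB -!poly_funE -rP subrr.
have s_lin : linear s.
  move=> c f g; rewrite [f]rP [g]rP !sP.
  have -> : c *: poly_fun X (r f) + poly_fun X (r g) = poly_fun X (c *: r f + r g).
    by apply/cr_eqP => u; rewrite cr_addE cr_scaleE !poly_funE mevalD mevalZ.
  by rewrite sP rmorphD /= mmapZ /= mulr_algl.
have s_mon : monoid_morphism s.
  split.
    have -> : 1 = poly_fun X 1 by apply/cr_eqP => u; rewrite poly_funE meval1.
    by rewrite sP rmorph1.
  move=> f g; rewrite [f]rP [g]rP !sP.
  have -> : poly_fun X (r f) * poly_fun X (r g) = poly_fun X (r f * r g).
    by apply/cr_eqP => u; rewrite cr_mulE !poly_funE mevalM.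
  by rewrite sP rmorphM.
by exists (Points s_lin s_mon).
Qed.

Definition eval_fun (u : av_pt X) (f : coord_ring X) : k^o := f u.

Fact eval_linear u : linear (eval_fun u). Proof. by []. Qed.
Fact eval_monoid u : monoid_morphism (eval_fun u). Proof. by []. Qed.

Definition eval_point u : points X k^o := Points (@eval_linear u) (eval_monoid u).

Lemma eval_point_ex (s : points X k^o) : exists u, s = eval_point u.
Proof.
pose v j : k := s (poly_fun X 'X_j).
have sE p : s (poly_fun X p) = p.@[v].
  by rewrite points_coord -mmap_id; apply: eq_mmap => c; exact: mulr1.
have vX : av_set X v.
  apply: mem_vanishing => p pX; rewrite -sE -(raddf0 s); congr (s _).
  by apply/cr_eqP => u; rewrite poly_funE pX.
exists (SigSub (mem_set vX)); apply/pointsP => f.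
by have [p ->] := coord_ring_poly f; rewrite sE.
Qed.

End EvalPoints.

Arguments vanishing {k} X _.

Section Action.
Variables (k : closedFieldType) (G : alg_group k) (X : affvar k).
Variable a : alg_action G X.

(** As [phi] depends on [u] and [f] only, one function on [H] computes the value of [f]
at pairs with constant second component over all algebras. *)
Lemma fst_slice (H Y : affvar k) (f : coord_ring (prod_var H Y)) (u : av_pt Y) :
  exists phi : coord_ring H, (forall h, phi h = f (pair_pt h u)) /\
    forall (A : comAlgType k) (g : points H A) (s : points Y A),
      (forall e, s e = (e u : k)%:A) -> pair_points g s f = g phi.
Proof.
have [c fc] := decomp_ex f; exists (\sum_(p <- c) (p.2 u : k) *: p.1); split.
  move=> h; rewrite fc cr_sumE; apply: eq_bigr => p _.
  by rewrite cr_scaleE mulrC.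
move=> A g s su; rewrite /= (pair_points_funE g s fc) linear_sum.
by apply: eq_bigr => p _; rewrite linearZ su /= mulr_algr.
Qed.

Lemma snd_slice (H Y : affvar k) (f : coord_ring (prod_var H Y)) (h : av_pt H) :
  exists phi : coord_ring Y, forall u, phi u = f (pair_pt h u).
Proof.
have [c fc] := decomp_ex f; exists (\sum_(p <- c) (p.1 h : k) *: p.2) => u.
by rewrite fc cr_sumE; apply: eq_bigr => p _; rewrite cr_scaleE.
Qed.

Lemma act_points_eval (h : av_pt G) (u : av_pt X) :
  act_points a (eval_point h) (eval_point u) = eval_point (a (pair_pt h u)).
Proof.
apply/pointsP => f; have [phi [phiE phiA]] := fst_slice (pullback a f) u.
transitivity (eval_point h phi); last exact: phiE.
by apply: phiA => e; exact/esym/mulr1.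
Qed.

Lemma orbit_fun_ex (u : av_pt X) (f : coord_ring X) :
  exists phi : coord_ring G, (forall h, phi h = f (a (pair_pt h u))) /\
    forall (A : comAlgType k) (g : points G A) (s : points X A),
      (forall e, s e = (e u : k)%:A) -> act_points a g s f = g phi.
Proof. exact: (fst_slice (pullback a f) u). Qed.

Lemma orbit_eval (h : av_pt G) (u : av_pt X) :
  orbit_points a (eval_point u) (eval_point (a (pair_pt h u))).
Proof. by exists (eval_point h) => //; rewrite act_points_eval. Qed.

Lemma const_point_eval (u : av_pt X) (f : coord_ring X) :
  points_map (@laurent_of_fps k \o @fps_of_scalar k) (eval_point u) f = (f u : k)%:A.
Proof.
rewrite /= /fps_of_scalar /eval_fun.
by rewrite -[LHS]mulr1.
Qed.

(** For [f] vanishing on the orbit of [x] and [h] in [G], the function f(h . _)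
pulls back to zero under the orbit map, hence vanishes along the arc. *)
Lemma closure_of_arc x y (Xi : points X (fps k)) (g : points G (laurent k)) :
    points_map (@laurent_of_fps k) Xi =
      act_points a g (points_map (@laurent_of_fps k \o @fps_of_scalar k) x) ->
    points_map (@fps_at0 k) Xi = y ->
  orbit_points a y `<=` zariski_closure (orbit_points a x).
Proof.
move=> XiE yE s [h0 _ <-] C [[I CI] OC].
have [h hE] := eval_point_ex h0; have [v vE] := eval_point_ex y.
have [u uE] := eval_point_ex x.
rewrite CI => f If.
have [fh fhE] := snd_slice (pullback a f) h.
have -> : act_points a h0 y f = y fh.
  by rewrite hE vE act_points_eval; apply/esym/fhE.
rewrite -yE /=; suff -> : Xi fh = 0 by rewrite raddf0.
have [phi [phiE phiA]] := orbit_fun_ex u fh.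
have XiL : laurent_of_fps (Xi fh) = g phi.
  move/pointsP/(_ fh): XiE; rewrite uE => XiE; apply: (etrans XiE).
  by apply: phiA; exact: const_point_eval.
have phi0 : phi = 0.
  apply/cr_eqP => h'; pose h'' := ag_mul G (pair_pt h h').
  transitivity (f (a (pair_pt h'' u))); first by rewrite phiE fhE aa_mul.
  have : C (eval_point (a (pair_pt h'' u))) by apply: OC; rewrite uE; exact: orbit_eval.
  by rewrite CI => /(_ f If).
move: XiL; rewrite phi0 raddf0 => /eqP.
by rewrite /laurent_of_fps tofrac_eq0 => /eqP.
Qed.

Lemma meval_mmap n l (b : 'I_l -> {mpoly k[n]}) q (w : 'I_n -> k) :
  (mmap (@mpolyC n k) b q).@[w] = q.@[fun j => (b j).@[w]].
Proof. by rewrite mmap_comp; apply: eq_mmap => c; exact: mevalC. Qed.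

(** The coordinates of the arc are the power series given by [mpoly_laurent]; they
satisfy the equations of [X] because k[[t]] embeds into k((t)), where they are the
coordinates of [g . x]. *)
Lemma arc_of_closure (x y : points X k^o) :
    orbit_points a y `<=` zariski_closure (orbit_points a x) ->
  exists Xi : points X (fps k),
    (exists g : points G (laurent k), points_map (@laurent_of_fps k) Xi =
       act_points a g (points_map (@laurent_of_fps k \o @fps_of_scalar k) x)) /\
    points_map (@fps_at0 k) Xi = y.
Proof.
have [u ->] := eval_point_ex x; have [v ->] := eval_point_ex y => yx.
have {}yx (f : coord_ring X) : (forall h, f (a (pair_pt h u)) = 0) -> f v = 0.
  move=> f0; have /yx : orbit_points a (eval_point v) (eval_point v).
    by rewrite -{2}(aa_one a v); exact: orbit_eval.
  move=> /(_ [set s : points X k^o | s f = 0]); apply; split; first exists [set f].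
    apply/seteqP; split=> s /= sf; first by move=> _ ->.
    exact: sf.
  move=> s [h _ <-]; have [h' ->] := eval_point_ex h.
  by rewrite act_points_eval; exact: f0.
have /choice[phi phiP] j := orbit_fun_ex u (poly_fun X 'X_j).
have /choice[b bP] j := coord_ring_poly (phi j).
have bE h j : (b j).@[val h] = val (a (pair_pt h u)) j.
  by rewrite -poly_funE -bP (phiP j).1 poly_funE mevalXU.
have [|g [s [gG gs s0]]] := @mpoly_laurent k _ _ (vanishing G) b (val v) (vanishing_ideal G).
  move=> q qb; apply: (yx (poly_fun X q)) => h; have := qb h.
  by rewrite meval_mmap => qh; rewrite poly_funE -[RHS]qh; apply: meval_eq => j; rewrite bE.
have evE p : mmap (GRing.in_alg (laurent k)) g p =
    mmap (@laurent_of_fps k \o @fps_of_scalar k) g p.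
  by apply: eq_mmap => c; exact: mulr1.
have [gp gpE] : exists gp : points G (laurent k), forall p,
    gp (poly_fun G p) = mmap (GRing.in_alg (laurent k)) g p.
  by apply: points_of_coord => p pG; rewrite evE; exact: gG.
have [Xi XiE] : exists Xi : points X (fps k), forall p,
    Xi (poly_fun X p) = mmap (GRing.in_alg (fps k)) s p.
  apply: points_of_coord => q qX; apply/eqP; rewrite -tofrac_eq0.
  rewrite -[tofrac _]/(laurent_of_fps _) mmap_comp; apply/eqP.
  have -> : @laurent_of_fps k \o s = fun j => mmap (GRing.in_alg (laurent k)) g (b j).
    by apply/funext => j; rewrite evE gs.
  have qb : vanishing G (mmap (@mpolyC _ k) b q).
    move=> h; rewrite meval_mmap -[RHS](qX (a (pair_pt h u))).
    by apply: meval_eq => j; exact: bE.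
  rewrite -(gG _ qb) -evE mmap_comp; apply: eq_mmap => c.
  by rewrite /= mmapC; exact/esym/mulr1.
exists Xi; split.
  exists gp; apply: points_ext => j.
  rewrite ((phiP j).2 _ gp _ (const_point_eval u)) bP gpE /= XiE mmapX mmap1U.
  by rewrite evE -gs.
apply: points_ext => j; rewrite /= XiE mmapX mmap1U.
by rewrite /fps_at0 s0 /eval_fun poly_funE mevalXU.
Qed.

End Action.

Theorem theorem2p2 (k : closedFieldType) (X : affvar k) (G : alg_group k)
    (a : alg_action G X) (x y : points X k^o) :
  orbit_points a y `<=` zariski_closure (orbit_points a x) <->
  exists Xi : points X (fps k),
    (exists g : points G (laurent k),
       points_map (@laurent_of_fps k) Xi =
       act_points a g (points_map (@laurent_of_fps k \o @fps_of_scalar k) x)) /\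
    points_map (@fps_at0 k) Xi = y.
Proof.
split; first exact: arc_of_closure.
by case=> Xi [[g XiE] yE]; exact: (closure_of_arc XiE yE).
Qed.
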